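(* Let $K$ be an infinite field, $\mathbf{Vec}$ the category of finite-dimensional vector spaces over $K$, $\ell$ a positive integer, and $P$ a functor from $\mathbf{Vec}^\ell$ to $\mathbf{Vec}$ such that for any $\underline{V},\underline{W}\in\mathbf{Vec}^\ell$ the map $\operatorname{Hom}_{\mathbf{Vec}^\ell}(\underline{V},\underline{W})\to\operatorname{Hom}_{\mathbf{Vec}}(P(\underline{V}),P(\underline{W}))$ is polynomial of uniformly bounded degree. Then $P$ is a Noetherian $\mathbf{Vec}^\ell$-topological space.
   Context: $\mathbf{Vec}^\ell$ is the $\ell$-fold product category; its morphisms $(V_1,\dots,V_\ell)\to(W_1,\dots,W_\ell)$ are $\ell$-tuples of linear maps $V_i\to W_i$. Each finite-dimensional vector space $P(\underline{V})$ carries the Zariski topology. A closed $\mathbf{Vec}^\ell$-subspace $X$ of $P$ is a rule assigning to each $\underline{V}\in\mathbf{Vec}^\ell$ a Zariski-closed subset $X(\underline{V})\subseteq P(\underline{V})$ such that $P(\varphi)(X(\underline{V}))\subseteq X(\underline{W})$ for every morphism $\varphi:\underline{V}\to\underline{W}$. $P$ is a Noetherian $\mathbf{Vec}^\ell$-topological space if every descending chain of closed $\mathbf{Vec}^\ell$-subspaces of $P$ stabilises (from some index on, simultaneously for all $\underline{V}$). *)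

(* Defs.v *)
From HB Require Import structures.
From mathcomp Require Import all_boot all_order all_algebra.
From mathcomp Require Import mpoly.
Set Implicit Arguments.
Unset Strict Implicit.
Unset Printing Implicit Defensive.

Import GRing.Theory.
Local Open Scope ring_scope.

Definition infinite (K : eqType) : Prop := forall s : seq K, exists x, x \notin s.

Section VecFunctors.
Variables (K : fieldType) (l : nat).

Definition vec_obj := 'I_l -> vectType K.

Definition vec_hom (V W : vec_obj) := forall i, 'Hom(V i, W i).

Definition vec_id (V : vec_obj) : vec_hom V V := fun i => \1%VF.

Definition vec_comp (U V W : vec_obj) (g : vec_hom V W) (f : vec_hom U V) :
  vec_hom U W := fun i => (g i \o f i)%VF.

Record vec_functor := VecFunctor {
  fobj :> vec_obj -> vectType K;
  fmap : forall V W : vec_obj, vec_hom V W -> 'Hom(fobj V, fobj W);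
  fmap_id : forall V : vec_obj, fmap (vec_id V) = \1%VF;
  fmap_comp : forall (U V W : vec_obj) (g : vec_hom V W) (f : vec_hom U V),
    fmap (vec_comp g f) = (fmap g \o fmap f)%VF
}.

(* The notions below do not depend on the choice of basis, since a linear change
   of coordinates preserves polynomials and their degree. *)
Definition coords (A : vectType K) (v : A) : 'rV[K]_(\dim {:A}) :=
  passmx.rVof (vbasis {:A}) v.

(* Hom(V, W) is the product of the spaces Hom(V_i, W_i); its coordinates are
   those of the components, concatenated. *)
Definition vec_hom_dim (V W : vec_obj) : nat :=
  \sum_(i < l) \dim {: 'Hom(V i, W i)}.

Definition vec_hom_coords (V W : vec_obj) (f : vec_hom V W) :
    'rV[K]_(vec_hom_dim V W) :=
  \mxrow_(i < l) coords (f i).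

(* msize p is the total degree of p plus one, and 0 for p = 0. *)
Definition polynomial_of_degree_le (d : nat) (V W : vec_obj) (B : vectType K)
    (F : vec_hom V W -> B) : Prop :=
  exists p : 'I_(\dim {:B}) -> {mpoly K[vec_hom_dim V W]},
    (forall j, (msize (p j) <= d.+1)%N) /\
    (forall f j, coords (F f) 0 j = (p j).@[vec_hom_coords f 0]).

Definition polynomial_of_bounded_degree (P : vec_functor) : Prop :=
  exists d : nat, forall V W : vec_obj,
    polynomial_of_degree_le d (@fmap P V W).

Definition zariski_closed (A : vectType K) (S : A -> Prop) : Prop :=
  exists E : {mpoly K[\dim {:A}]} -> Prop,
    forall v : A, S v <-> (forall p, E p -> p.@[coords v 0] = 0).

Record closed_subspace (P : vec_functor) := ClosedSubspace {
  points :> forall V : vec_obj, P V -> Prop;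
  points_closed : forall V : vec_obj, zariski_closed (@points V);
  points_fmap : forall (V W : vec_obj) (f : vec_hom V W) (x : P V),
    points x -> points (fmap P f x)
}.

Definition noetherian (P : vec_functor) : Prop :=
  forall X : nat -> closed_subspace P,
    (forall n (V : vec_obj) (x : P V), X n.+1 V x -> X n V x) ->
    exists N, forall n, (N <= n)%N ->
      forall (V : vec_obj) (x : P V), X n V x <-> X N V x.

End VecFunctors.

(* Main.v *)
Require Import Defs.
From mathcomp Require Import all_boot all_order all_algebra.
From mathcomp Require Import mpoly.
From HB Require Import structures.
From Stdlib Require Import Classical ClassicalEpsilon FunctionalExtensionality.
Set Implicit Arguments.
Unset Strict Implicit.
Unset Printing Implicit Defensive.
Import GRing.Theory.
Local Open Scope ring_scope.

(** The lowest coefficient is used because [q] is minimal over all points of [Z] and all directions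
    in [B + R]: no mixed terms survive, so [r |-> dircoef f q x r] is additive. It is also
    homogeneous of degree [q], so one nonzero value forces [a |-> a ^+ q] to be additive on [K], and
    the characteristic never has to be named. Being [q]-semilinear, it is a linear form on the
    Frobenius twist of [R] rather than on [R]; over an imperfect field an irreducible quotient can
    become reducible after twisting, and this is the obstacle behind the replacement of [B]. The
    induction terminates because inclusion of a subfunctor of pure degree [d] in another subfunctor
    can be tested at ['I_d]. Hence a single number, a bound on the rank at ['I_d] of the degree [d]
    part modulo [B], drops when [R] is added to [B]. Shifting by [W] does not raise it: a letter of
    [W] becomes a parameter, so words containing one have smaller degree in [V]. The shifted functor
    keeps its shape, with [U + W] in the place of [U]. *)

(** After restricting [P] to the diagonal, [x] in [P(V, .., V)] is determined by the polynomial map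
    [f |-> P(f) x] on [Hom(V, K^d)], so [P] is a subquotient of a functor [V |-> (U (+) V)^{(x) I}],
    and it suffices to treat the quotients of the latter by subfunctors [B].

    This is done by Draisma's argument. Let [d] be the degree of the quotient and [R] a subfunctor of
    its degree [d] part which is irreducible over [B]. By induction the quotient by [B + R] is
    Noetherian. Given a closed subfunctor [X] which is strictly smaller than the closure [Z] of
    [X + R], take an equation [f] of [X] that does not vanish on [Z], and let [h] be the lowest
    nonconstant coefficient of [f (x + t r)], for some [r] in [R]. Where [h] vanishes one argues by
    induction on [deg f]. Where [h] does not vanish, applying [f] to the images of
    [x] in [(U (+) (W (+) V))^{(x) I}] under [id (+) (id | t psi)] and taking the coefficient of
    [t ^+ (d * q)] gives equations, linear in [q]-th powers, from which the [R V]-component of [x] can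
    be eliminated; the problem thus passes to a shifted functor modulo [R], whose degree [d] part is
    smaller. To make the elimination work over an imperfect field, [B] is first replaced by a
    suitable Frobenius twist. When [d = 0] the statement is Hilbert's basis theorem. *)

(** * Polynomial functions and the Zariski topology *)

Lemma eq_fun (A B : Type) (f g : A -> B) :
  (forall x, f x = g x) -> (fun x => f x) = (fun x => g x).
Proof. exact: functional_extensionality. Qed.

Lemma dependent_choice (A : Type) (B : A -> Type) (Q : forall a, B a -> Prop) :
  (forall a, exists b, Q a b) -> exists f, forall a, Q a (f a).
Proof.
move=> ex; exists (fun a => sval (constructive_indefinite_description _ (ex a))) => a.
by case: constructive_indefinite_description.
Qed.

Section PolynomialFunctions.
Variable K : fieldType.

(** Polynomial functions of degree at most [d], generated without reference to a basis. *)
Inductive poldeg (E : vectType K) : nat -> (E -> K) -> Prop :=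
| poldeg_const c : poldeg 0 (fun=> c)
| poldeg_lin (g : E -> K) : scalar g -> poldeg 1 g
| poldeg_add d f g : poldeg d f -> poldeg d g -> poldeg d (fun x => f x + g x)
| poldeg_mul d e f g :
    poldeg d f -> poldeg e g -> poldeg (d + e) (fun x => f x * g x)
| poldeg_le d e f : (d <= e)%N -> poldeg d f -> poldeg e f.

Definition polyfun (E : vectType K) (f : E -> K) := exists d, poldeg d f.

Lemma polyfun_const (E : vectType K) c : polyfun (fun _ : E => c).
Proof. by exists 0%N; constructor. Qed.

Lemma polyfun_lin (E : vectType K) (g : E -> K) : scalar g -> polyfun g.
Proof. by move=> g_lin; exists 1%N; constructor. Qed.

Lemma polyfunD (E : vectType K) (f g : E -> K) :
  polyfun f -> polyfun g -> polyfun (fun x => f x + g x).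
Proof.
move=> [d f_d] [e g_e]; exists (maxn d e); apply: poldeg_add.
  exact: poldeg_le (leq_maxl _ _) f_d.
exact: poldeg_le (leq_maxr _ _) g_e.
Qed.

Lemma polyfunM (E : vectType K) (f g : E -> K) :
  polyfun f -> polyfun g -> polyfun (fun x => f x * g x).
Proof. by move=> [d f_d] [e g_e]; exists (d + e)%N; apply: poldeg_mul. Qed.

Lemma polyfunN (E : vectType K) (f : E -> K) :
  polyfun f -> polyfun (fun x => - f x).
Proof.
move=> f_pol; have -> : (fun x => - f x) = (fun x => (-1) * f x).
  by apply: functional_extensionality => x; rewrite mulN1r.
by apply: polyfunM => //; apply: polyfun_const.
Qed.

Lemma polyfunX (E : vectType K) (f : E -> K) n :
  polyfun f -> polyfun (fun x => f x ^+ n).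
Proof.
move=> f_pol; elim: n => [|n IHn].
  by under eq_fun => x do rewrite expr0; apply: polyfun_const.
by under eq_fun => x do rewrite exprS; apply: polyfunM.
Qed.

Lemma polyfun_sum (E : vectType K) (I : Type) (r : seq I) (P : pred I)
    (F : I -> E -> K) :
  (forall i, polyfun (F i)) -> polyfun (fun x => \sum_(i <- r | P i) F i x).
Proof.
move=> F_pol; elim: r => [|i r IHr].
  by under eq_fun => x do rewrite big_nil; apply: polyfun_const.
under eq_fun => x do rewrite big_cons.
by case: (P i) => //; apply: polyfunD.
Qed.

Lemma polyfun_prod (E : vectType K) (I : Type) (r : seq I) (P : pred I)
    (F : I -> E -> K) :
  (forall i, polyfun (F i)) -> polyfun (fun x => \prod_(i <- r | P i) F i x).
Proof.
move=> F_pol; elim: r => [|i r IHr].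
  by under eq_fun => x do rewrite big_nil; apply: polyfun_const.
under eq_fun => x do rewrite big_cons.
by case: (P i) => //; apply: polyfunM.
Qed.

Lemma polyfun_ind (E : vectType K) (Q : (E -> K) -> Prop) :
    (forall c, Q (fun=> c)) -> (forall g, scalar g -> Q g) ->
    (forall f g, Q f -> Q g -> Q (fun x => f x + g x)) ->
    (forall f g, Q f -> Q g -> Q (fun x => f x * g x)) ->
  forall f, polyfun f -> Q f.
Proof.
by move=> Qc Ql QD QM f [d]; elim=> //= *; [apply: QD|apply: QM].
Qed.

Lemma polyfun_comp (E F : vectType K) (L : E -> F) (f : F -> K) :
    (forall g : F -> K, scalar g -> polyfun (fun x => g (L x))) ->
  polyfun f -> polyfun (fun x => f (L x)).
Proof.
move=> L_pol; elim/polyfun_ind=> [c|g|g h|g h]; first exact: polyfun_const.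
- exact: L_pol.
- exact: polyfunD.
- exact: polyfunM.
Qed.

Lemma scalar_comp (E F : vectType K) (L : E -> F) (g : F -> K) :
  linear L -> scalar g -> scalar (fun x => g (L x)).
Proof. by move=> L_lin g_lin a x y; rewrite L_lin g_lin. Qed.

Lemma polyfun_comp_lin (E F : vectType K) (L : E -> F) (f : F -> K) :
  linear L -> polyfun f -> polyfun (fun x => f (L x)).
Proof.
move=> L_lin; apply: polyfun_comp => g g_lin.
by apply: polyfun_lin; apply: scalar_comp.
Qed.

Section ScalarTheory.
Variables (E : vectType K) (g : E -> K).
Hypothesis g_lin : scalar g.

Lemma scalarf0 : g 0 = 0.
Proof. by have := g_lin (-1) 0 0; rewrite scaler0 addr0 mulN1r addNr. Qed.

Lemma scalarfD x y : g (x + y) = g x + g y.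
Proof. by have := g_lin 1 x y; rewrite scale1r mul1r. Qed.

Lemma scalarfZ a x : g (a *: x) = a * g x.
Proof. by have := g_lin a x 0; rewrite !addr0 scalarf0 addr0. Qed.

Lemma scalarf_sum (I : Type) (r : seq I) (P : pred I) (F : I -> E) :
  g (\sum_(i <- r | P i) F i) = \sum_(i <- r | P i) g (F i).
Proof.
elim: r => [|i r IHr]; first by rewrite !big_nil scalarf0.
by rewrite !big_cons; case: (P i); rewrite ?scalarfD IHr.
Qed.

End ScalarTheory.

Lemma polyfun_translate (E : vectType K) (r : E) (f : E -> K) :
  polyfun f -> polyfun (fun x => f (x + r)).
Proof.
apply: polyfun_comp => g g_lin.
have -> : (fun x => g (x + r)) = (fun x => g x + g r).
  by apply: functional_extensionality => x; rewrite scalarfD.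
by apply: polyfunD; [apply: polyfun_lin|apply: polyfun_const].
Qed.

End PolynomialFunctions.

Section ZariskiClosure.
Variable K : fieldType.

Definition zclosure (E : vectType K) (S : E -> Prop) (x : E) : Prop :=
  forall p, polyfun p -> (forall y, S y -> p y = 0) -> p x = 0.

Definition zclosed (E : vectType K) (S : E -> Prop) := forall x, zclosure S x -> S x.

Lemma sub_zclosure (E : vectType K) (S : E -> Prop) x : S x -> zclosure S x.
Proof. by move=> Sx p _; apply. Qed.

Lemma zclosure_mono (E : vectType K) (S S' : E -> Prop) x :
  (forall y, S y -> S' y) -> zclosure S x -> zclosure S' x.
Proof. by move=> SS' clSx p p_pol pS'; apply: clSx => // y /SS'; apply: pS'. Qed.

Lemma zclosed_zclosure (E : vectType K) (S : E -> Prop) : zclosed (zclosure S).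
Proof. by move=> x clx p p_pol pS; apply: clx => // y; apply. Qed.

Lemma zclosure_image (E F : vectType K) (L : E -> F) (S : E -> Prop) (S' : F -> Prop) :
    (forall p, polyfun p -> polyfun (fun x => p (L x))) ->
    (forall y, S y -> zclosure S' (L y)) ->
  forall x, zclosure S x -> zclosure S' (L x).
Proof.
move=> L_pol SS' x clSx p p_pol pS'.
by apply: (clSx (fun x => p (L x))) => [|y /SS']; [apply: L_pol|apply].
Qed.

Lemma zclosed_preim (E F : vectType K) (L : E -> F) (S : F -> Prop) :
    (forall p, polyfun p -> polyfun (fun x => p (L x))) ->
  zclosed S -> zclosed (fun x => S (L x)).
Proof.
move=> L_pol S_closed x clx; apply: S_closed.
by apply: zclosure_image clx => // y; apply: sub_zclosure.
Qed.

Lemma nzclosed_witness (E : vectType K) (S : E -> Prop) x : zclosed S -> ~ S x ->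
  exists p, [/\ polyfun p, forall y, S y -> p y = 0 & p x != 0].
Proof.
move=> S_closed nSx; apply: NNPP => no_p; apply: nSx; apply: S_closed => p p_pol pS.
by apply/eqP; case: eqP => // /eqP px; case: no_p; exists p.
Qed.

End ZariskiClosure.

(** * Curves and their coefficients over an infinite field *)

Section Infinite.
Variables (K : fieldType) (hK : infinite K).

Lemma infinite_uniq n : exists s : seq K, uniq s /\ size s = n.
Proof.
elim: n => [|n [s [s_uniq s_size]]]; first by exists [::].
by have [x xs] := hK s; exists (x :: s); rewrite /= xs s_uniq s_size.
Qed.

(** Needed for [f t = t ^+ q]: over an imperfect field the [q]-th powers do not exhaust [K], but
    there are still infinitely many of them. *)
Lemma poly_inj_eq0 (f : K -> K) (p : {poly K}) :
  injective f -> (forall t, p.[f t] = 0) -> p = 0.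
Proof.
move=> f_inj pf0; apply/eqP; apply: contraT => p_neq0.
have [s [s_uniq s_size]] := infinite_uniq (size p).
have := max_poly_roots (rs := map f s) p_neq0.
rewrite size_map s_size ltnn map_inj_uniq // s_uniq; apply => //.
by apply/allP => _ /mapP[t _ ->]; apply/rootP.
Qed.

Lemma poly_funext (p q : {poly K}) : (forall t, p.[t] = q.[t]) -> p = q.
Proof.
move=> pq; apply/eqP; rewrite -subr_eq0; apply/eqP.
by apply: (@poly_inj_eq0 id) => // t; rewrite hornerE hornerN pq subrr.
Qed.

(** Meaningful only when [u] is a polynomial function of [t]. *)
Definition polyOf (u : K -> K) : {poly K} :=
  epsilon (inhabits 0) (fun p : {poly K} => forall t, u t = p.[t]).

Definition coefT (u : K -> K) k := (polyOf u)`_k.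

Lemma coefTE u (p : {poly K}) k : (forall t, u t = p.[t]) -> coefT u k = p`_k.
Proof.
move=> up; rewrite /coefT; suff -> : polyOf u = p by [].
apply: poly_funext => t; rewrite -up /polyOf.
by have -> := epsilon_spec (inhabits 0)
  (fun p : {poly K} => forall t, u t = p.[t]) (ex_intro _ p up).
Qed.

(** Curves in [E] parametrised by [t], whose coefficients depend polynomially on a point of [E']. *)
Definition polyfam (E' E : vectType K) (A : E' -> K -> E) :=
  forall g : E -> K, scalar g -> exists G : E' -> {poly K},
    (forall x t, g (A x t) = (G x).[t]) /\
    (forall k, polyfun (fun x => (G x)`_k)).

Lemma polyfamP (E' E : vectType K) (A : E' -> K -> E) (f : E -> K) :
    polyfam A -> polyfun f ->
  exists G : E' -> {poly K},
    (forall x t, f (A x t) = (G x).[t]) /\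
    (forall k, polyfun (fun x => (G x)`_k)).
Proof.
move=> A_pol; elim/polyfun_ind => [c|g /A_pol//|g h|g h].
- exists (fun=> c%:P); split=> [x t|k]; first by rewrite hornerC.
  exact: polyfun_const.
- move=> [G [GE G_pol]] [H [HE H_pol]]; exists (fun x => G x + H x); split=> [x t|k].
    by rewrite hornerD GE HE.
  by under eq_fun => x do rewrite coefD; apply: polyfunD.
- move=> [G [GE G_pol]] [H [HE H_pol]]; exists (fun x => G x * H x); split=> [x t|k].
    by rewrite hornerM GE HE.
  under eq_fun => x do rewrite coefM.
  by apply: polyfun_sum => i; apply: polyfunM.
Qed.

Lemma polyfam_coefT (E' E : vectType K) (A : E' -> K -> E) (f : E -> K) k :
  polyfam A -> polyfun f -> polyfun (fun x => coefT (fun t => f (A x t)) k).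
Proof.
move=> A_pol /(polyfamP A_pol)[G [GE G_pol]].
by under eq_fun => x do rewrite (coefTE k (GE x)).
Qed.

Definition polycurve (E : vectType K) (A : K -> E) :=
  forall f, polyfun f -> exists p : {poly K}, forall t, f (A t) = p.[t].

Lemma polyfam_curve (E' E : vectType K) (A : E' -> K -> E) x :
  polyfam A -> polycurve (A x).
Proof. by move=> A_pol f /(polyfamP A_pol)[G [GE _]]; exists (G x). Qed.

Lemma polyfam_line (E : vectType K) (r : E) : polyfam (fun x t => x + t *: r).
Proof.
move=> g g_lin; exists (fun x => (g x)%:P + (g r)%:P * 'X); split=> [x t|k].
  by rewrite scalarfD // scalarfZ // !hornerE mulrC.
under eq_fun => x do rewrite coefD coefC coefCM.
apply: polyfunD; last exact: polyfun_const.
by case: (k == 0)%N; [apply: polyfun_lin|apply: polyfun_const].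
Qed.

(** The drop from [d] to [d - k] drives the induction on the degree of an equation. The case [d < k]
    is separate because truncated subtraction would only give a constant there, while vanishing is
    needed for products. *)
Lemma poldeg_line (E : vectType K) (r : E) d (f : E -> K) k : poldeg d f ->
  if (k <= d)%N then poldeg (d - k) (fun x => coefT (fun t => f (x + t *: r)) k)
  else forall x, coefT (fun t => f (x + t *: r)) k = 0.
Proof.
move=> f_d.
suff [G GE G_deg] : exists2 G : E -> {poly K},
    forall x t, f (x + t *: r) = (G x).[t] &
    forall k, if (k <= d)%N then poldeg (d - k) (fun x => (G x)`_k)
              else forall x, (G x)`_k = 0.
  have := G_deg k; case: leqP => _ Gk; last by move=> x; rewrite (coefTE k (GE x)).
  by under eq_fun => x do rewrite (coefTE k (GE x)).
move: k => _.
elim: d f / f_d => [c|g g_lin|d f g _ [F FE F_deg] _ [G GE G_deg]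
                   |d e f g _ [F FE F_deg] _ [G GE G_deg]|d e f de _ [F FE F_deg]].
- exists (fun=> c%:P) => [x t|[|k]] /=; first by rewrite hornerC.
    by under eq_fun => x do rewrite coefC; apply: poldeg_const.
  by move=> _; rewrite coefC.
- exists (fun x => (g x)%:P + (g r)%:P * 'X) => [x t|[|[|k]]] /=.
  + by rewrite scalarfD // scalarfZ // !hornerE mulrC.
  + under eq_fun => x do rewrite coefD coefC coefCM coefX mulr0 addr0.
    exact: poldeg_lin.
  + under eq_fun => x do rewrite coefD coefC coefCM coefX add0r.
    exact: poldeg_const.
  + by move=> x; rewrite coefD coefC coefCM coefX mulr0 addr0.
- exists (fun x => F x + G x) => [x t|k]; first by rewrite hornerD FE GE.
  move: (F_deg k) (G_deg k); case: ifP => _ Fk Gk; last by move=> x; rewrite coefD Fk Gk addr0.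
  by under eq_fun => x do rewrite coefD; apply: poldeg_add.
- exists (fun x => F x * G x) => [x t|k]; first by rewrite hornerM FE GE.
  (* Only the terms in range for both factors are kept, so that their degrees [d - i] and
     [e - (k - i)] add up to [d + e - k]. *)
  have coefE x : (F x * G x)`_k =
      \sum_(i <- index_enum 'I_k.+1 | (i <= d)%N && (k - i <= e)%N) (F x)`_i * (G x)`_(k - i).
    rewrite coefM [RHS]big_mkcond /=; apply: eq_bigr => i _.
    move: (F_deg i) (G_deg (k - i)%N).
    by case: (i <= d)%N => [_|->]; case: (_ <= e)%N => [|->] //=; rewrite ?mul0r ?mulr0.
  case: ifP => k_le; last first.
    move=> x; rewrite coefE big1 // => i /andP[id ki]; case/negP: (negbT k_le).
    by rewrite -(subnKC (ltn_ord i : (i <= k)%N)) leq_add.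
  under eq_fun => x do rewrite coefE.
  elim: (index_enum 'I_k.+1) => [|i s IHs].
    under eq_fun => x do rewrite big_nil.
    exact: poldeg_le (leq0n _) (poldeg_const _ _).
  under eq_fun => x do rewrite big_cons.
  case: (boolP ((i <= d)%N && (k - i <= e)%N)) => [/andP[i_d ki]|_] //.
  apply: poldeg_add => //.
  move: (F_deg i) (G_deg (k - i)%N); rewrite i_d ki => Fi Gi.
  apply: poldeg_le (poldeg_mul Fi Gi).
  have ik : (i <= k)%N by rewrite -ltnS.
  by rewrite addnBA // addnBAC // -subnDA subnKC.
- exists F => // k; move: (F_deg k); case: (leqP k d) => kd Fk.
    by rewrite (leq_trans kd de); apply: poldeg_le Fk; apply: leq_sub2r.
  case: ifP => // _; have -> : (fun x => (F x)`_k) = fun=> 0.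
    exact: functional_extensionality.
  exact: poldeg_le (leq0n _) (poldeg_const _ _).
Qed.

End Infinite.

(** * Noetherianity of affine space *)

Section HilbertBasis.

Definition ideal (R : comNzRingType) (I : R -> Prop) :=
  [/\ I 0, forall a b, I a -> I b -> I (a + b) & forall a b, I b -> I (a * b)].

Definition acc_ideals (R : comNzRingType) := forall I : nat -> R -> Prop,
  (forall n, ideal (I n)) -> (forall n a, I n a -> I n.+1 a) ->
  exists N, forall n a, (N <= n)%N -> I n a -> I N a.

Lemma chain_incr (T : Type) (I : nat -> T -> Prop) :
    (forall n a, I n a -> I n.+1 a) ->
  forall m n a, (m <= n)%N -> I m a -> I n a.
Proof.
move=> I_incr m n a /subnKC <-; elim: (n - m)%N => [|k IHk]; first by rewrite addn0.
by move=> /IHk /I_incr; rewrite addnS.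
Qed.

Lemma acc_field (K : fieldType) : acc_ideals K.
Proof.
move=> I I_ideal I_incr.
have [[n [a Ina a0]]|I0] := classic (exists n, exists2 a, I n a & a != 0).
  exists n => m b _ _; have [_ _ IM] := I_ideal n.
  by rewrite -[b](divfK a0); apply: IM.
exists 0%N => n a _ Ina; have [I00 _ _] := I_ideal 0%N.
by case: (eqVneq a 0) => [->//|a0]; case: I0; exists n, a.
Qed.

(** Hilbert's basis theorem, through the ideals [L n k] of coefficients in degree [k] of the
    elements of [I n] of degree at most [k], which increase in both [n] and [k]. *)
Lemma acc_poly (R : comNzRingType) : acc_ideals R -> acc_ideals {poly R}.
Proof.
move=> accR I I_ideal I_incr.
pose L n k c := exists f : {poly R}, [/\ I n f, (size f <= k.+1)%N & f`_k = c].
have L_ideal n k : ideal (L n k).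
  have [I0 ID IM] := I_ideal n; split.
  - by exists 0; split; rewrite ?size_poly0 ?coef0.
  - move=> a b [f [If szf <-]] [g [Ig szg <-]]; exists (f + g); split; first exact: ID.
      by rewrite (leq_trans (size_polyD _ _)) // geq_max szf szg.
    by rewrite coefD.
  - move=> a b [f [If szf <-]]; exists (a%:P * f); split; first exact: IM.
      by rewrite mul_polyC (leq_trans (size_scale_leq _ _)).
    by rewrite coefCM.
have L_incr n m k j c : (n <= m)%N -> (k <= j)%N -> L n k c -> L m j c.
  move=> nm kj [f [If szf <-]]; have [_ _ IM] := I_ideal m.
  exists ('X^(j - k) * f); split.
  - by apply: IM; apply: chain_incr nm If.
  - rewrite (leq_trans (size_polyMleq _ _)) // size_polyXn addSn /=.
    by rewrite (leq_trans (leq_add (leqnn _) szf)) // addnS subnK.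
  - by rewrite coefXnM ltnNge leq_subr /= subKn.
(* The diagonal chain settles all degrees from [N] on; the degrees below [N] are finitely many
   chains, settled one by one. *)
have [N LN] := accR (fun n => L n n) (fun n => L_ideal n n)
  (fun n a => L_incr _ _ _ _ _ (leqnSn n) (leqnSn n)).
have [M NM LM] : exists2 M, (N <= M)%N &
    forall k n c, (k < N)%N -> (M <= n)%N -> L n k c -> L M k c.
  suff [M LM] : exists M, forall k n c, (k < N)%N -> (M <= n)%N -> L n k c -> L M k c.
    exists (maxn N M); first exact: leq_maxl.
    move=> k n c kN; rewrite geq_max => /andP[_ Mn] /(LM _ _ _ kN Mn).
    by apply: L_incr => //; apply: leq_maxr.
  elim: {1}N => [|m [M IHm]]; first by exists 0%N.
  have [M' LM'] := accR (fun n => L n m) (fun n => L_ideal n m)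
    (fun n a => L_incr _ _ _ _ _ (leqnSn n) (leqnn m)).
  exists (maxn M M') => k n c; rewrite ltnS leq_eqVlt geq_max => /orP[/eqP->|km] /andP[Mn M'n].
    by move=> /(LM' _ _ M'n); apply: L_incr => //; apply: leq_maxr.
  by move=> /(IHm _ _ _ km Mn); apply: L_incr => //; apply: leq_maxl.
have {}LM k n c : (M <= n)%N -> L n k c -> L M k c.
  move=> Mn; case: (ltnP k N) => [kN|Nk Lc]; first exact: LM.
  apply: (L_incr N _ N) => //; apply: (LN (maxn n k)).
    by rewrite leq_max Nk orbT.
  by apply: L_incr Lc; rewrite ?leq_maxl ?leq_maxr.
exists M => n f Mn; have [I0 ID _] := I_ideal M; have [_ IDn IMn] := I_ideal n.
(* Subtracting an element of [I M] with the same top coefficient lowers the size of [f]. *)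
move: {2}(size f) (leqnn (size f)) => k; elim: k f => [|k IHk] f szf If.
  by move: szf; rewrite leqn0 size_poly_eq0 => /eqP->.
have [g [Ig szg gk]] : L M k f`_k by apply: (LM k n) => //; exists f.
rewrite -(subrK g f); apply: (ID) => //; apply: IHk; last first.
  by rewrite -mulN1r; apply: (IDn) => //; apply: IMn; apply: chain_incr Mn Ig.
apply/leq_sizeP => j; rewrite leq_eqVlt coefB => /orP[/eqP<-|kj].
  by rewrite gk subrr.
by rewrite !nth_default ?subrr // (leq_trans _ kj).
Qed.

(** [R] is an iterated polynomial ring with one variable for each function in [gs]; all that is used
    of it is its evaluation at the points of [X]. *)
Lemma acc_functions (K : fieldType) (X : Type) (gs : seq (X -> K)) :
  exists2 R : comNzRingType, acc_ideals R & exists ev : X -> {rmorphism R -> K},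
    (forall c, exists a, forall x, ev x a = c) /\
    (forall i, (i < size gs)%N -> exists a, forall x, ev x a = nth (fun=> 0) gs i x).
Proof.
elim: gs => [|g gs [R accR [ev [evC evgs]]]].
  exists K; first exact: acc_field.
  by exists (fun=> idfun); split=> // c; exists c.
have com x : commr_rmorph (ev x) (g x) by move=> a; apply: mulrC.
exists {poly R}; first exact: acc_poly.
exists (fun x => horner_morph (com x)); split=> [c|[|i]] /=.
- by have [a aE] := evC c; exists a%:P => x; rewrite horner_morphC aE.
- by exists 'X => x; rewrite horner_morphX.
- by move=> /evgs[a aE]; exists a%:P => x; rewrite horner_morphC aE.
Qed.

Lemma chain_decr (T : Type) (X : nat -> T -> Prop) :
    (forall n x, X n.+1 x -> X n x) ->
  forall m n x, (m <= n)%N -> X n x -> X m x.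
Proof.
move=> X_decr m n x /subnKC <-; elim: (n - m)%N => [|k IHk]; first by rewrite addn0.
by rewrite addnS => /X_decr.
Qed.

(** The vanishing ideals in a Noetherian ring of polynomials in the coordinates increase, and a
    closed set is recovered from its ideal. *)
Lemma zclosed_dcc (K : fieldType) (E : vectType K) (X : nat -> E -> Prop) :
    (forall n, zclosed (X n)) -> (forall n x, X n.+1 x -> X n x) ->
  exists N, forall n x, (N <= n)%N -> X N x -> X n x.
Proof.
move=> X_closed X_decr.
pose b := vbasis {:E}.
have [R accR [ev [evC evb]]] :=
  acc_functions [seq (coord b i : E -> K) | i <- enum 'I_(\dim {:E})].
have ev_pol f : polyfun f -> exists a, forall x, ev x a = f x.
  elim/polyfun_ind => [c|g g_lin|g h [a aE] [c cE]|g h [a aE] [c cE]].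
  - exact: evC.
  - have [a aE] : exists a, forall i x, ev x (a i) = coord b i x * g b`_i.
      apply: (dependent_choice (Q := fun i a => forall x, ev x a = coord b i x * g b`_i)) => i.
      have [a aE] : exists a, forall x, ev x a = coord b i x.
        have [|a aE] := evb i; first by rewrite size_map size_enum_ord.
        by exists a => x; rewrite aE (nth_map i) ?size_enum_ord // nth_ord_enum.
      by have [c cE] := evC (g b`_i); exists (a * c) => x; rewrite rmorphM aE cE.
    exists (\sum_i a i) => x; rewrite rmorph_sum /= {2}(coord_vbasis (memvf x)).
    rewrite (scalarf_sum g_lin); apply: eq_bigr => i _.
    by rewrite (scalarfZ g_lin) aE.
  - by exists (a + c) => x; rewrite rmorphD aE cE.
  - by exists (a * c) => x; rewrite rmorphM aE cE.
pose I n a := forall x, X n x -> ev x a = 0.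
have [||N IN] := accR I.
- move=> n; split=> [x _|a c Ia Ic x Xx|a c Ic x Xx]; first exact: rmorph0.
    by rewrite rmorphD Ia // Ic // addr0.
  by rewrite rmorphM Ic // mulr0.
- by move=> n a Ina x /X_decr; apply: Ina.
exists N => n x Nn XNx; apply: X_closed => p p_pol pX.
have [a aE] := ev_pol p p_pol; rewrite -aE.
by apply: (IN n) => // y Xy; rewrite aE; apply: pX.
Qed.

End HilbertBasis.

(** * Linear algebra *)

Section LinearAlgebra.
Variable K : fieldType.

(** Were [S] not a subspace of this type, every subspace inside it could be enlarged by a line,
    giving unbounded dimensions. *)
Lemma vspace_of_pred (E : vectType K) (S : E -> Prop) :
    S 0 -> (forall a x y, S x -> S y -> S (a *: x + y)) ->
  exists V : {vspace E}, forall x, x \in V <-> S x.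
Proof.
move=> S0 S_lin; apply: NNPP => noV.
suff V_ex k : exists2 V : {vspace E}, (k <= \dim V)%N & forall x, x \in V -> S x.
  by have [V] := V_ex (\dim {:E}).+1; rewrite ltnNge dimvS ?subvf.
elim: k => [|k [V kV VS]]; first by exists 0%VS => // x; rewrite memv0 => /eqP->.
have [x Sx xV] : exists2 x, S x & x \notin V.
  apply: NNPP => no_x; apply: noV; exists V => x; split=> [/VS//|Sx].
  by apply: contraT => xV; case: no_x; exists x.
exists (<[x]> + V)%VS => [|_ /memv_addP[_ /vlineP[a ->] [v /VS Sv ->]]]; last exact: S_lin.
rewrite dimv_disjoint_sum ?dim_vline.
  by case: eqVneq xV => [->|_ _]; rewrite ?mem0v.
apply/eqP; rewrite -subv0; apply/subvP => v; rewrite memv_cap => /andP[/vlineP[a ->]].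
rewrite memv0; have [-> _|a0] := eqVneq a 0; first by rewrite scale0r.
by move=> /(memvZ a^-1); rewrite scalerA mulVf // scale1r (negPf xV).
Qed.

(** Coordinates on [R] modulo [S]: [y] is a basis of a complement of [S :&: R] in [R], and the [l i]
    are its dual forms, extended to [E] so as to vanish on [S]. *)
Lemma relative_basis (E : vectType K) (S R : {vspace E}) :
  exists n (y : 'I_n -> E) (l : 'I_n -> E -> K),
    [/\ forall i, y i \in R, forall i, scalar (l i),
        forall i x, x \in S -> l i x = 0,
        forall i j, l i (y j) = (i == j)%:R
      & forall r, r \in R -> r - \sum_i l i r *: y i \in S].
Proof.
pose C := (R :\: S)%VS; have CS0 : (C :&: S = 0)%VS by apply: capv_diff.
exists (\dim C), (fun i => (vbasis C)`_i), (fun i x => coord (vbasis C) i (daddv_pi C S x)).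
split=> [i|i a x z|i x xS|i j|r rR].
- by apply: (subvP (diffvSl R S)); apply: vbasis_mem; rewrite mem_nth ?size_tuple.
- by rewrite !linearP.
- suff -> : daddv_pi C S x = 0 by rewrite linear0.
  have := daddv_pi_add CS0 (subvP (addvSr C S) _ xS).
  rewrite (daddv_pi_id _ xS) ?[(S :&: C)%VS]capvC // => /(canRL (addrK _)) ->.
  exact: subrr.
- rewrite daddv_pi_id //; last by apply: vbasis_mem; rewrite mem_nth ?size_tuple.
  by by rewrite coord_free ?(basis_free (vbasisP C)) // eq_sym.
- have rCS : r \in (C + S)%VS by rewrite addv_diff (subvP (addvSl R S)).
  rewrite -(coord_vbasis (memv_pi _ _ _)) -{1}(daddv_pi_add CS0 rCS) addrAC subrr add0r.
  exact: memv_pi.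
Qed.

Lemma scalar_separates (E : vectType K) (S : {vspace E}) x : x \notin S ->
  exists g : E -> K, [/\ scalar g, forall s, s \in S -> g s = 0 & g x != 0].
Proof.
move=> xS; have [n [y [l [_ l_lin lS _ y_span]]]] := relative_basis S {:E}.
apply: NNPP => no_g; case/negP: xS; have := y_span x (memvf x).
rewrite big1 ?subr0 // => i _; suff -> : l i x = 0 by rewrite scale0r.
by apply/eqP; apply: contraT => lx; case: no_g; exists (l i); split=> //; apply: lS.
Qed.

(** Bounding ranks by spanning families, rather than computing them, makes the bounds pass to
    Frobenius twists and linear images. *)
Definition spanned_mod (E : vectType K) (S : {vspace E}) (Q : E -> Prop) m :=
  exists s : seq E, (size s <= m)%N /\ forall x, Q x -> x \in (S + <<s>>)%VS.

Lemma spanned_mod_sub (E : vectType K) (S S' : {vspace E}) (Q Q' : E -> Prop) m :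
    (S <= S')%VS -> (forall x, Q' x -> Q x) ->
  spanned_mod S Q m -> spanned_mod S' Q' m.
Proof.
move=> SS' QQ' [s [sm sQ]]; exists s; split=> // x /QQ'/sQ.
by apply: subvP; apply: addvS.
Qed.

Lemma spanned_mod_dim (E : vectType K) (S T : {vspace E}) m : (S <= T)%VS ->
  (\dim T <= \dim S + m)%N -> spanned_mod S (fun x => x \in T) m.
Proof.
move=> ST dimT; exists (vbasis (T :\: S)%VS); split=> [|x].
  rewrite size_tuple -(leq_add2r (\dim S)) -dimv_disjoint_sum ?capv_diff //.
  by rewrite addv_diff (addv_idPl ST) addnC.
rewrite (span_basis (vbasisP _)) addvC addv_diff.
exact/subvP/addvSl.
Qed.

Lemma spanned_mod_le (E : vectType K) (S T : {vspace E}) (Q : E -> Prop) m :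
    (S <= T)%VS -> (\dim T <= \dim S + m)%N -> (forall x, Q x -> x \in T) ->
  spanned_mod S Q m.
Proof.
by move=> ST dimT QT; apply: (spanned_mod_sub (subvv S) QT); apply: spanned_mod_dim.
Qed.

Lemma dim_addv_span (E : vectType K) (S : {vspace E}) (s : seq E) m :
  (size s <= m)%N -> (\dim (S + <<s>>) <= \dim S + m)%N.
Proof.
move=> sm; have := dimv_add_leqif S <<s>>%VS => -[le_dim _].
by rewrite (leq_trans le_dim) // leq_add2l (leq_trans (dim_span s)).
Qed.

Lemma dim_ltv (E : vectType K) (S T : {vspace E}) x :
  (S <= T)%VS -> x \in T -> x \notin S -> (\dim S < \dim T)%N.
Proof.
move=> ST xT xS; rewrite (ltn_leqif (dimv_leqif_sup ST)).
by apply: contra xS => /subvP; apply.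
Qed.

(** Makes the rank drop when [B] is enlarged by [R]. *)
Lemma spanned_mod_extend (E : vectType K) (S S' : {vspace E}) (Q : E -> Prop) m r :
    (S <= S')%VS -> Q r -> r \in S' -> r \notin S -> spanned_mod S Q m ->
  (0 < m)%N /\ spanned_mod S' Q m.-1.
Proof.
move=> SS' Qr rS' rS [s [sm sQ]]; have dimT := dim_addv_span S sm.
have rSr : r \in (S + <[r]>)%VS by apply: (subvP (addvSr _ _)); apply: memv_line.
have dimSr := dim_ltv (addvSl S _) rSr rS.
have SrT : (S + <[r]> <= S + <<s>>)%VS.
  by rewrite subv_add addvSl /=; apply: sQ.
have m0 : (0 < m)%N.
  by rewrite -(ltn_add2l (\dim S)) addn0 (leq_trans dimSr) // (leq_trans (dimvS SrT)).
split=> //; apply: (@spanned_mod_sub _ (S + <[r]>)%VS _ Q) => //.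
  by rewrite subv_add SS'.
apply: spanned_mod_le SrT _ sQ; apply: leq_trans dimT _.
by rewrite -{1}(prednK m0) -addSnnS leq_add2r.
Qed.

(** Makes the rank of [R] drop when it is replaced by a part that is proper modulo [S]; this
    contradicts minimality in the proof of irreducibility. *)
Lemma spanned_mod_proper (E : vectType K) (S R N : {vspace E}) m :
    (N <= R)%VS -> ~~ (R <= N + S)%VS -> spanned_mod S (fun x => x \in R) m ->
  (0 < m)%N /\ spanned_mod S (fun x => x \in N) m.-1.
Proof.
move=> NR /subvPn[r rR rNS] [s [sm sQ]]; have dimT := dim_addv_span S sm.
have NST : (N + S <= S + <<s>>)%VS.
  by rewrite subv_add addvSl andbT (subv_trans NR) //; apply/subvP.
have dimNS := dim_ltv NST (sQ r rR) rNS.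
have lt_m := leq_trans dimNS dimT.
have m0 : (0 < m)%N.
  by rewrite -(ltn_add2l (\dim S)) addn0 (leq_ltn_trans (dimvS (addvSr N S))).
split=> //; apply: (@spanned_mod_le _ _ (N + S)%VS).
- exact: addvSr.
- by move: lt_m; rewrite -{1}(prednK m0) addnS.
- by apply/subvP/addvSl.
Qed.

(** The hypothesis says that the rows in [P] span. As long as fewer than [m] independent ones are
    chosen, some nonzero column is killed by all of them, and a row in [P] that does not kill it can
    be added. *)
Lemma row_family_unitmx m (P : 'rV[K]_m -> Prop) :
    (forall w : 'cV_m, (forall r, P r -> r *m w = 0) -> w = 0) ->
  exists A : 'M_m, (forall i, P (row i A)) /\ A \in unitmx.
Proof.
move=> P_sep.
suff [A [PA rkA]] : exists A : 'M_m, (forall i, P (row i A)) /\ \rank A = m.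
  by exists A; split=> //; rewrite -row_full_unit /row_full rkA.
suff A_ex k : (k <= m)%N ->
    exists A : 'M_(k, m), (forall i, P (row i A)) /\ \rank A = k by apply: A_ex.
elim: k => [_|k IHk km]; first by exists 0; split=> [[]//|]; rewrite mxrank0.
have [A [PA rkA]] := IHk (ltnW km).
have [j wj] : exists j, col j (cokermx A) != 0.
  apply/existsP; apply: contraLR km; rewrite negb_exists => /forallP col0.
  suff /eqP : \rank (cokermx A) = 0%N by rewrite mxrank_coker rkA subn_eq0 -leqNgt.
  apply/eqP; rewrite mxrank_eq0; apply/eqP/matrixP => i j.
  by have /negPn/eqP/colP/(_ i) := col0 j; rewrite !mxE.
have [r Pr rw] : exists2 r, P r & r *m col j (cokermx A) != 0.
  apply: NNPP => no_r; case/eqP: wj; apply: P_sep => r Pr.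
  by apply/eqP; apply: contraT => rw; case: no_r; exists r.
have rA : ~~ (r <= A)%MS.
  apply: contra rw; rewrite submxE => /eqP rc.
  by rewrite colE mulmxA rc mul0mx.
have PrA (i : 'I_(1 + k)) : P (row i (col_mx r A)).
  case: (split_ordP i) => i' ->; last by rewrite rowKd.
  by rewrite rowKu ord1 row_id.
exists (col_mx r A : 'M_(1 + k, m)); split=> //.
have : (\rank A < \rank (col_mx r A))%N.
  by rewrite -addsmxE; apply: rank_ltmx; rewrite ltmxE addsmxSr /= addsmx_sub negb_and rA.
by rewrite rkA => lt_k; apply/eqP; rewrite eqn_leq lt_k rank_leq_row.
Qed.

End LinearAlgebra.

(** * Tensors and Frobenius twists *)

Section FiniteFunctions.
Variables (K : fieldType) (J : finType).

Lemma scalar_ffunE (g : {ffun J -> K^o} -> K) (x : {ffun J -> K^o}) :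
  scalar g -> g x = \sum_j x j * g [ffun j' => (j' == j)%:R].
Proof.
move=> g_lin; have {1}-> : x = \sum_j x j *: [ffun j' => (j' == j)%:R] :> {ffun J -> K^o}.
  apply/ffunP => j; rewrite sum_ffunE (bigD1 j) //= !ffunE eqxx [_ *: _]mulr1.
  rewrite big1 ?addr0 // => j' jj'; rewrite !ffunE eq_sym (negPf jj').
  exact: mulr0.
by rewrite scalarf_sum //; apply: eq_bigr => j _; rewrite scalarfZ.
Qed.

Lemma ffunZE a (x : {ffun J -> K^o}) j : (a *: x) j = a * x j :> K.
Proof. by rewrite ffunE. Qed.

Lemma ffunBE (x y : {ffun J -> K^o}) j : (x - y) j = x j - y j :> K.
Proof. by rewrite !ffunE. Qed.

Lemma scalar_coordinate (j : J) : scalar (fun x : {ffun J -> K^o} => x j : K).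
Proof. by move=> a x y; rewrite !ffunE. Qed.

Lemma polyfun_coordinate (j : J) : polyfun (fun x : {ffun J -> K^o} => x j : K).
Proof. exact/polyfun_lin/scalar_coordinate. Qed.

Lemma polyfun_into_ffun (E : vectType K) (L : E -> {ffun J -> K^o}) (f : {ffun J -> K^o} -> K) :
  (forall j, polyfun (fun x => L x j : K)) -> polyfun f -> polyfun (fun x => f (L x)).
Proof.
move=> L_pol; apply: polyfun_comp => g g_lin.
under eq_fun => x do rewrite scalar_ffunE //.
by apply: polyfun_sum => j; apply: polyfunM; [apply: L_pol|apply: polyfun_const].
Qed.

Lemma polyfam_ffun (E : vectType K) (A : E -> K -> {ffun J -> K^o}) :
    (forall j, exists G : E -> {poly K}, (forall x t, A x t j = (G x).[t]) /\
       (forall k, polyfun (fun x => (G x)`_k))) ->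
  polyfam A.
Proof.
move=> /dependent_choice[G GE] g g_lin.
exists (fun x => \sum_j (G j x) * (g [ffun j' => (j' == j)%:R])%:P); split=> [x t|k].
  rewrite scalar_ffunE // horner_sum; apply: eq_bigr => j _.
  by rewrite hornerM hornerC (GE j).1.
under eq_fun => x do rewrite coef_sum.
apply: polyfun_sum => j; under eq_fun => x do rewrite coefMC.
by apply: polyfunM; [apply: (GE j).2|apply: polyfun_const].
Qed.

End FiniteFunctions.

Section Frobenius.
Variables (K : fieldType).

(** A power of the characteristic exponent, in a form that needs no case distinction on it. *)
Definition frobenius_exponent q := (0 < q)%N /\ forall a b : K, (a + b) ^+ q = a ^+ q + b ^+ q.

Lemma frob_sum q (J : Type) (r : seq J) (P : pred J) (F : J -> K) : frobenius_exponent q ->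
  (\sum_(j <- r | P j) F j) ^+ q = \sum_(j <- r | P j) F j ^+ q.
Proof.
move=> [q0 qD]; elim: r => [|j r IHr]; first by rewrite !big_nil expr0n eqn0Ngt q0.
by rewrite !big_cons; case: (P j) => //; rewrite qD IHr.
Qed.

Lemma frob_inj q : frobenius_exponent q -> injective (fun a : K => a ^+ q).
Proof.
move=> [q0 qD] a b /= ab.
have /eqP : (a - b) ^+ q = 0 by apply: (addIr (b ^+ q)); rewrite -qD subrK add0r.
by rewrite expf_eq0 q0 subr_eq0 => /eqP.
Qed.

Definition frobmap (J : finType) q (x : {ffun J -> K^o}) : {ffun J -> K^o} :=
  [ffun j => (x j : K) ^+ q].

Lemma frobmapD (J : finType) q (x y : {ffun J -> K^o}) : frobenius_exponent q ->
  frobmap q (x + y) = frobmap q x + frobmap q y.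
Proof. by move=> [_ qD]; apply/ffunP => j; rewrite !ffunE; apply: qD. Qed.

Lemma frobmapZ (J : finType) q a (x : {ffun J -> K^o}) : frobmap q (a *: x) = a ^+ q *: frobmap q x.
Proof. by apply/ffunP => j; rewrite !ffunE; apply: exprMn. Qed.

Lemma frobmap0 (J : finType) q : (0 < q)%N -> frobmap q (0 : {ffun J -> K^o}) = 0.
Proof. by move=> q0; apply/ffunP => j; rewrite !ffunE expr0n eqn0Ngt q0. Qed.

Lemma frobmap_sum (J I : finType) q (F : I -> {ffun J -> K^o}) : frobenius_exponent q ->
  frobmap q (\sum_i F i) = \sum_i frobmap q (F i).
Proof.
move=> q_frob; elim/big_rec2: _ => [|i x y _ <-]; first exact: frobmap0 q_frob.1.
exact: frobmapD.
Qed.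

(** The subspace of the Frobenius twist obtained from [S] by extending scalars along [a |-> a ^+ q]. *)
Definition frobspan (J : finType) q (S : {vspace {ffun J -> K^o}}) : {vspace {ffun J -> K^o}} :=
  <<map (frobmap q) (vbasis S)>>%VS.

Lemma mem_frobspan (J : finType) q (S : {vspace {ffun J -> K^o}}) x : frobenius_exponent q ->
  x \in S -> frobmap q x \in frobspan q S.
Proof.
move=> q_frob /coord_vbasis->; rewrite frobmap_sum //; apply: memv_suml => i _.
rewrite frobmapZ; apply: memvZ; apply: memv_span; apply: map_f.
by rewrite mem_nth ?size_tuple.
Qed.

Lemma frobspan_sub (J : finType) q (S T : {vspace {ffun J -> K^o}}) :
  (forall x, x \in S -> frobmap q x \in T) -> (frobspan q S <= T)%VS.
Proof. by move=> ST; apply/span_subvP => _ /mapP[x /vbasis_mem/ST xT ->]. Qed.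

Lemma scalar_frobmap (J : finType) q (g : {ffun J -> K^o} -> K) :
    frobenius_exponent q -> scalar g ->
  exists2 h : {ffun J -> K^o} -> K, scalar h & forall x, h (frobmap q x) = g x ^+ q.
Proof.
move=> q_frob g_lin.
exists (fun x => \sum_j x j * g [ffun j' => (j' == j)%:R] ^+ q) => [a x y|x].
  rewrite mulr_sumr -big_split /=; apply: eq_bigr => j _.
  by rewrite !ffunE mulrDl mulrA.
by rewrite scalar_ffunE // frob_sum //; apply: eq_bigr => j _; rewrite ffunE exprMn.
Qed.

Lemma polyfun_frobmap (J : finType) q (f : {ffun J -> K^o} -> K) :
    frobenius_exponent q -> polyfun f ->
  exists2 h : {ffun J -> K^o} -> K, polyfun h & forall x, h (frobmap q x) = f x ^+ q.
Proof.
move=> q_frob; elim/polyfun_ind => [c|g g_lin|g h [g' g'p g'E] [h' h'p h'E]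
                                    |g h [g' g'p g'E] [h' h'p h'E]].
- by exists (fun=> c ^+ q) => //; apply: polyfun_const.
- by have [h /polyfun_lin] := scalar_frobmap q_frob g_lin; exists h.
- exists (fun x => g' x + h' x) => [|x]; first exact: polyfunD.
  by rewrite q_frob.2 g'E h'E.
- exists (fun x => g' x * h' x) => [|x]; first exact: polyfunM.
  by rewrite exprMn g'E h'E.
Qed.

Hypothesis hK : infinite K.

(** Tuples of [q]-th powers are Zariski dense: the coordinates are freed one at a time, each along a
    line on which a polynomial in one variable vanishes at all [q]-th powers. *)
Lemma frobmap_dense (J : finType) q (u : {ffun J -> K^o} -> K) :
    frobenius_exponent q -> polyfun u ->
  (forall x, u (frobmap q x) = 0) -> forall x, u x = 0.
Proof.
move=> q_frob u_pol u_tw x.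
suff u0 (s : seq J) (y : {ffun J -> K^o}) :
    (forall j, j \notin s -> exists a : K, y j = a ^+ q :> K) -> u y = 0.
  by apply: (u0 (enum J)) => j; rewrite mem_enum.
elim: s y => [|j s IHs] y y_tw.
  have [z zE] := dependent_choice (fun j => y_tw j isT).
  by rewrite -(u_tw (finfun z)); congr u; apply/ffunP => j; rewrite !ffunE.
pose e : {ffun J -> K^o} := [ffun j' => (j' == j)%:R].
have [p pE] := polyfam_curve (y - y j *: e) (@polyfam_line K _ e) u_pol.
have p0 : p = 0.
  apply: (poly_inj_eq0 hK (frob_inj q_frob)) => a /=; rewrite -pE; apply: IHs => j' j's.
  have [->|jj'] := eqVneq j' j; rewrite !ffunE ?eqxx ?(negPf jj').
    by exists a; rewrite /GRing.scale /= !mulr1 subrr add0r.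
  have [|b ->] := y_tw j'; first by rewrite inE negb_or jj'.
  by exists b; rewrite /GRing.scale /= !mulr0 subr0 addr0.
by have := pE (y j); rewrite subrK p0 horner0.
Qed.

End Frobenius.

Section Tensors.
Variables (K : fieldType) (I : finType).

Local Notation tens L := {ffun {ffun I -> L} -> K^o}.

(** [tens L] is the tensor power of [K^L] indexed by [I], in the basis of words, and [act f] is the
    tensor power of the matrix [f], with rows indexed by the target. *)
Definition act (L L' : finType) (f : L' -> L -> K) (x : tens L) : tens L' :=
  [ffun w' : {ffun I -> L'} => \sum_(w : {ffun I -> L}) (\prod_i f (w' i) (w i)) * x w].

Definition mulm (L L' L'' : finType) (f : L'' -> L' -> K) (g : L' -> L -> K)
    (a : L'') (c : L) : K :=
  \sum_b f a b * g b c.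

Definition idm (L : finType) (a b : L) : K := (a == b)%:R.

Lemma act_linear (L L' : finType) (f : L' -> L -> K) : linear (act f).
Proof.
move=> a x y; apply/ffunP => w; rewrite ffunE [RHS]ffunE ffunZE !ffunE.
rewrite mulr_sumr -big_split /=; apply: eq_bigr => v _.
by rewrite ffunE ffunZE mulrDr mulrCA.
Qed.

Lemma act_comp (L L' L'' : finType) (f : L'' -> L' -> K) (g : L' -> L -> K) x :
  act f (act g x) = act (mulm f g) x.
Proof.
apply/ffunP => w; rewrite !ffunE.
under eq_bigr => v _ do rewrite ffunE mulr_sumr.
rewrite exchange_big /=; apply: eq_bigr => u _.
under eq_bigr => v _ do rewrite mulrA -big_split /=.
by rewrite -mulr_suml /mulm bigA_distr_bigA.
Qed.

Lemma act_pull (L L' : finType) (f : L' -> L -> K) x (w' : {ffun I -> L'}) (g : {ffun I -> L}) :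
  (forall i b, f (w' i) b = (b == g i)%:R) -> act f x w' = x g.
Proof.
move=> fE; rewrite ffunE (bigD1 g) //= big1 ?mul1r => [|i _]; last by rewrite fE eqxx.
rewrite big1 ?addr0 // => w wg.
have [i wi] : exists i, w i != g i.
  apply/existsP; apply: contraR wg; rewrite negb_exists => /forallP wg.
  by apply/eqP/ffunP => i; apply/eqP; rewrite -[_ == _]negbK.
by rewrite (bigD1 i) //= fE (negPf wi) !mul0r.
Qed.

Lemma act_zero (L L' : finType) (f : L' -> L -> K) x (w' : {ffun I -> L'}) i :
  (forall b, f (w' i) b = 0) -> act f x w' = 0.
Proof.
by move=> fi; rewrite ffunE big1 // => w _; rewrite (bigD1 i) //= fi !mul0r.
Qed.

Lemma act_id (L : finType) (x : tens L) : act (@idm L) x = x.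
Proof. by apply/ffunP => w; apply: act_pull => i b; rewrite /idm eq_sym. Qed.

Lemma frobmap_act q (L L' : finType) (f : L' -> L -> K) x : frobenius_exponent K q ->
  frobmap q (act f x) = act (fun a b => f a b ^+ q) (frobmap q x).
Proof.
move=> q_frob; apply/ffunP => w; rewrite !ffunE frob_sum //.
by apply: eq_bigr => v _; rewrite ffunE exprMn prodrXl.
Qed.

Lemma polyfun_act (L L' : finType) (x : tens L) (E : vectType K) (f : E -> L' -> L -> K)
    (p : tens L' -> K) :
    (forall a b, polyfun (fun y => f y a b)) -> polyfun p ->
  polyfun (fun y => p (act (f y) x)).
Proof.
move=> f_pol; apply: polyfun_into_ffun => w.
under eq_fun => y do rewrite ffunE.
apply: polyfun_sum => v; apply: polyfunM; last exact: polyfun_const.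
exact: polyfun_prod.
Qed.

Lemma polyfam_act (L L' : finType) (f0 f1 : L' -> L -> K) :
  polyfam (fun (x : tens L) t => act (fun a b => f0 a b + t * f1 a b) x).
Proof.
apply: polyfam_ffun => w.
exists (fun x : tens L => \sum_(v : {ffun I -> L}) (x v : K) *:
  \prod_i ((f0 (w i) (v i))%:P + (f1 (w i) (v i))%:P * 'X)).
split=> [x t|k].
  rewrite ffunE horner_sum; apply: eq_bigr => v _.
  rewrite hornerZ horner_prod mulrC; congr (_ * _); apply: eq_bigr => i _.
  by rewrite !hornerE mulrC.
under eq_fun => x do rewrite coef_sum.
apply: polyfun_sum => v; under eq_fun => x do rewrite coefZ.
by apply: polyfunM; [apply: polyfun_coordinate|apply: polyfun_const].
Qed.

Section Blocks.
Variable U : finType.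

(** The map [id_U (+) f]: the functor [V |-> (U (+) V)^{(x) I}] is [tens (U + V)] with [act (blockm f)]. *)
Definition blockm (V W : finType) (f : W -> V -> K) (a : U + W) (b : U + V) : K :=
  match a, b with
  | inl u, inl u' => (u == u')%:R
  | inr w, inr v => f w v
  | _, _ => 0
  end.

Lemma mulm_blockm (V W X : finType) (f : X -> W -> K) (g : W -> V -> K) :
  mulm (blockm f) (blockm g) = blockm (mulm f g).
Proof.
apply: functional_extensionality => a; apply: functional_extensionality => c.
rewrite /mulm big_sumType /=; case: a c => [u|x] [u'|v] /=.
- rewrite [X in _ + X]big1 ?addr0 => [|w _]; last by rewrite mul0r.
  rewrite (bigD1 u) //= eqxx mul1r big1 ?addr0 // => u'' /negPf uu''.
  by rewrite eq_sym uu'' mul0r.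
- by rewrite !big1 ?addr0 // => [w _|u' _]; rewrite ?mul0r ?mulr0.
- by rewrite !big1 ?addr0 // => [w _|u _]; rewrite ?mul0r ?mulr0.
- by rewrite big1 ?add0r // => u _; rewrite mul0r.
Qed.

Lemma blockm_id (V : finType) : blockm (@idm V) = @idm (U + V)%type.
Proof.
apply: functional_extensionality => -[u|v]; apply: functional_extensionality => -[u'|v'] //=.
Qed.

Definition isr (V : finType) (a : U + V) : bool := if a is inr _ then true else false.

(** The grading by degree in [V]. Block diagonal matrices preserve it, and scaling the [V] block by
    [t] multiplies degree [d] by [t ^+ d]. *)
Definition vdeg (V : finType) (w : {ffun I -> (U + V)%type}) : nat := \sum_i isr (w i).

Definition pure_deg (V : finType) d (x : tens (U + V)%type) :=
  forall w, vdeg w != d -> x w = 0.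

Definition deg_ge (V : finType) d (x : tens (U + V)%type) :=
  forall w, (vdeg w < d)%N -> x w = 0.

Lemma prod_blockm_eq0 (V W : finType) (f : W -> V -> K) (w : {ffun I -> (U + W)%type}) v :
  vdeg w != vdeg v -> \prod_i blockm f (w i) (v i) = 0.
Proof.
move=> wv; have [i wvi] : exists i, isr (w i) != isr (v i).
  apply/existsP; apply: contraR wv; rewrite negb_exists => /forallP wv.
  apply/eqP; apply: eq_bigr => i _; congr nat_of_bool; apply/eqP.
  by rewrite -[_ == _]negbK.
by rewrite (bigD1 i) //=; case: (w i) (v i) wvi => [?|?] [?|?] //= _; rewrite mul0r.
Qed.

Lemma pure_deg_act (V W : finType) (f : W -> V -> K) d x :
  pure_deg d x -> pure_deg d (act (blockm f) x).
Proof.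
move=> x_d w wd; rewrite ffunE big1 // => v _.
have [vd|vd] := eqVneq (vdeg v) d; last by rewrite x_d // mulr0.
by rewrite prod_blockm_eq0 ?vd // mul0r.
Qed.

Lemma act_scale (V W : finType) (f : W -> V -> K) d t x : pure_deg d x ->
  act (blockm (fun a b => t * f a b)) x = t ^+ d *: act (blockm f) x.
Proof.
move=> x_d; apply/ffunP => w; rewrite ffunE ffunZE ffunE mulr_sumr; apply: eq_bigr => v _.
have [vd|vd] := eqVneq (vdeg v) d; last by rewrite x_d // !mulr0.
rewrite mulrA; congr (_ * _).
have [wv|wv] := eqVneq (vdeg w) (vdeg v); last by rewrite !prod_blockm_eq0 ?mulr0.
rewrite -vd -wv /vdeg -prodrXr -big_split /=; apply: eq_bigr => i _.
by case: (w i) (v i) => [?|?] [?|?] /=; rewrite ?expr0 ?expr1 ?mul1r ?mulr0.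
Qed.

End Blocks.

End Tensors.

(** * Subfunctors of tensor functors *)

Lemma indicator_span (K : fieldType) (E : vectType K) (G : {vspace E}) (S J : finType)
    (A : J -> {set S}) (v : J -> E) d :
    (forall j, #|A j| <= d)%N ->
    (forall X : {set S}, (#|X| <= d)%N -> \sum_(j | A j \subset X) v j \in G) ->
  \sum_j v j \in G.
Proof.
move=> A_le G_sub.
(* By inclusion-exclusion, the sum over each fibre [A j = X] is a combination of the given sums. *)
have GA n (X : {set S}) : (#|X| <= n)%N -> (#|X| <= d)%N -> \sum_(j | A j == X) v j \in G.
  elim: n X => [|n IHn] X Xn Xd.
    have := G_sub X Xd; move: Xn; rewrite leqn0 cards_eq0 => /eqP->.
    by under eq_bigl => j do rewrite subset0.
  have := G_sub X Xd; rewrite (bigID (fun j => A j == X)) /= rpredDr => [GX|].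
    apply: etrans GX; congr (_ \in G); apply: eq_bigl => j.
    by case: eqVneq => [->|]; rewrite ?subxx ?andbF.
  rewrite (partition_big A (fun Y : {set S} => Y \proper X)) /= => [|j]; last first.
    by rewrite properEneq andbC.
  apply: memv_suml => Y YX.
  rewrite (eq_bigl (fun j => A j == Y)) => [|j].
    apply: IHn; last exact: leq_trans (subset_leq_card (proper_sub YX)) Xd.
    by rewrite -ltnS (leq_trans (proper_card YX)).
  case: (eqVneq (A j) Y) => [->|]; rewrite ?andbF //.
  by rewrite andbT andbC -properEneq.
rewrite (partition_big A xpredT) //=; apply: memv_suml => X _.
have [Xd|dX] := leqP #|X| d; first exact: GA Xd.
by rewrite big1 ?mem0v // => j /eqP Aj; move: dX; rewrite -Aj ltnNge A_le.
Qed.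

Definition diagm (K : fieldType) (V : finType) (S : {set V}) (a b : V) : K :=
  ((a == b) && (a \in S))%:R.

(** A coordinate projection of rank at most [d] passes through [K^d]; this is how values at ['I_d]
    control those at every [V]. *)
Lemma diagm_factor (K : fieldType) (V : finType) (S : {set V}) d : (#|S| <= d)%N ->
  exists (f : V -> 'I_d -> K) (g : 'I_d -> V -> K), mulm f g = diagm K S.
Proof.
move=> Sd; exists (fun v (i : 'I_d) => ((v \in S) && (index v (enum S) == i :> nat))%:R),
  (fun (i : 'I_d) v => ((v \in S) && (index v (enum S) == i :> nat))%:R).
apply: functional_extensionality => v; apply: functional_extensionality => v'.
rewrite /mulm /diagm; have [vS|vS] := boolP (v \in S); last first.
  by rewrite big1 ?andbF // => i _; rewrite mul0r.
have idx_lt x : x \in S -> (index x (enum S) < d)%N.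
  by move=> xS; apply: leq_trans Sd; rewrite cardE index_mem mem_enum.
rewrite (bigD1 (Ordinal (idx_lt v vS))) //= eqxx mul1r big1 ?addr0 => [|i iv]; last first.
  rewrite [_ == _ :> nat]negbTE ?mul0r //.
  by apply: contra iv => /eqP iv; apply/eqP/val_inj.
rewrite andbT; congr (nat_of_bool _)%:R; have [<-|vv'] := eqVneq v v'; first by rewrite vS eqxx.
apply/negbTE; apply: contra vv' => /andP[v'S /eqP idx].
by apply/eqP; rewrite -(nth_index v (_ : v \in enum S)) ?mem_enum // -idx nth_index ?mem_enum.
Qed.

Section Subfunctors.
Variables (K : fieldType) (I : finType).
Hypothesis hK : infinite K.
Local Notation tens L := {ffun {ffun I -> L} -> K^o}.

Definition subfunctor (U : finType) (B : forall V : finType, {vspace tens (U + V)%type}) :=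
  forall (V W : finType) (f : W -> V -> K) x, x \in B V -> act (blockm f) x \in B W.

Section FixU.
Variable U : finType.
Implicit Types B N : forall V : finType, {vspace tens (U + V)%type}.

(** A word of degree [d] uses at most [d] letters of [V]. Projecting [x] to a set of at most [d]
    letters factors through [N 'I_d], hence lands in [B V], and [x] is a combination of such
    projections by inclusion-exclusion. *)
Lemma subfunctor_restrict d B N : subfunctor B -> subfunctor N ->
    (forall V x, x \in N V -> pure_deg d x) -> (N 'I_d <= B 'I_d)%VS ->
  forall V, (N V <= B V)%VS.
Proof.
move=> B_sub N_sub N_deg NB V; apply/subvP => x xN.
pose e w : tens (U + V)%type := [ffun w' => (w' == w)%:R].
have xE : x = \sum_w x w *: e w.
  apply/ffunP => w; rewrite sum_ffunE (bigD1 w) //= ffunZE ffunE eqxx mulr1.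
  by rewrite big1 ?addr0 // => w' w'w; rewrite ffunZE ffunE eq_sym (negPf w'w) mulr0.
(* Words of another degree have coefficient 0 in [x]; the value [set0] only keeps the cardinality
   bound. *)
pose A (w : {ffun I -> (U + V)%type}) : {set V} :=
  if vdeg w == d then [set v | [exists i, w i == inr v]] else set0.
rewrite xE; apply: (@indicator_span _ _ _ _ _ A _ d) => [w|S Sd].
  rewrite /A; case: eqP => [<-|_]; last by rewrite cards0.
  rewrite /vdeg -big_mkcond sum1_card.
  apply: leq_trans (_ : #|[set v | inr v \in [set w i | i in I & isr (w i)]]| <= _)%N.
    apply/subset_leq_card/subsetP => v; rewrite !inE => /existsP[i /eqP wi].
    by apply/imsetP; exists i; rewrite ?inE wi.
  rewrite -(card_imset _ (inr_inj : injective (@inr U V))).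
  apply: leq_trans (_ : #|[set w i | i in [pred i | isr (w i)]]| <= _)%N.
    apply/subset_leq_card/subsetP => _ /imsetP[v + ->]; rewrite inE => /imsetP[i].
    by rewrite inE => wi ->; apply: imset_f.
  by apply: leq_trans (leq_imset_card _ _) _.
have -> : \sum_(w | A w \subset S) x w *: e w = act (blockm (diagm K S)) x.
  apply/ffunP => w; rewrite sum_ffunE.
  have [wA|wA] := boolP (A w \subset S); last first.
    rewrite big1 => [|w' w'A]; last first.
      rewrite ffunZE ffunE; case: eqVneq wA => [->|_ _]; last by rewrite mulr0.
      by rewrite w'A.
    move: wA; rewrite /A; case: ifP => _; last by rewrite sub0set.
    case/subsetPn => v; rewrite inE => /existsP[i /eqP wi] vS.
    rewrite (act_zero _ (i := i)) // wi => -[//|v'] /=.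
    by rewrite /diagm (negPf vS) andbF.
  rewrite (bigD1 w) //= ffunZE ffunE eqxx mulr1 big1 ?addr0; last first.
    by move=> w' /andP[_ w'w]; rewrite ffunZE ffunE eq_sym (negPf w'w) mulr0.
  have [wd|wd] := eqVneq (vdeg w) d; last first.
    by rewrite (pure_deg_act _ (N_deg _ _ xN)) // (N_deg _ _ xN).
  apply/esym/act_pull => i b; move: wA; rewrite /A wd eqxx => /subsetP wA.
  case wi: (w i) b => [u|v] [u'|v'] //=; first by rewrite eq_sym.
  rewrite /diagm eq_sym wA ?andbT // inE; apply/existsP.
  by exists i; rewrite wi.
have [f [g fg]] := @diagm_factor K V S d Sd.
rewrite -fg -mulm_blockm -act_comp; apply: B_sub; apply: (subvP NB).
exact: N_sub.
Qed.
End FixU.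
End Subfunctors.

(** * Closed subfunctors *)

Section ClosedSubfunctors.
Variables (K : fieldType) (I : finType).
Hypothesis hK : infinite K.
Local Notation tens L := {ffun {ffun I -> L} -> K^o}.

Lemma polyfun_act_comp (L L' : finType) (f : L' -> L -> K) (p : tens L' -> K) :
  polyfun p -> polyfun (fun x => p (act f x)).
Proof. exact/polyfun_comp_lin/act_linear. Qed.

Lemma actD (L L' : finType) (f : L' -> L -> K) (x y : tens L) :
  act f (x + y) = act f x + act f y.
Proof. by have := act_linear f 1 x y; rewrite !scale1r. Qed.

Lemma act0 (L L' : finType) (f : L' -> L -> K) : act f (0 : tens L) = 0.
Proof. by apply: (addIr (act f 0)); rewrite -actD !add0r. Qed.

Lemma actZ (L L' : finType) (f : L' -> L -> K) a (x : tens L) : act f (a *: x) = a *: act f x.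
Proof. by have := act_linear f a x 0; rewrite act0 !addr0. Qed.

Lemma actN (L L' : finType) (f : L' -> L -> K) (x : tens L) : act f (- x) = - act f x.
Proof. by rewrite -!scaleN1r actZ. Qed.

Lemma act_sum (L L' J : finType) (f : L' -> L -> K) (F : J -> tens L) :
  act f (\sum_j F j) = \sum_j act f (F j).
Proof. by elim/big_rec2: _ => [|j x y _ <-]; rewrite ?act0 // actD. Qed.

Section FixU.
Variable U : finType.
Implicit Types B : forall V : finType, {vspace tens (U + V)%type}.
Implicit Types X : forall V : finType, tens (U + V)%type -> Prop.

(** Closed subfunctors of the quotient of [V |-> tens (U + V)] by [B], seen as [B]-invariant closed
    subfunctors upstairs. *)
Definition closed_subfunctor B X :=
  [/\ forall V, zclosed (@X V),
      forall (V W : finType) (f : W -> V -> K) x, X V x -> X W (act (blockm f) x)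
    & forall V x b, X V x -> b \in B V -> X V (x + b)].

Definition noetherian_mod B :=
  forall X : nat -> forall V : finType, tens (U + V)%type -> Prop,
    (forall n, closed_subfunctor B (X n)) -> (forall n V x, X n.+1 V x -> X n V x) ->
    exists N, forall n V x, (N <= n)%N -> X N V x -> X n V x.

Lemma closed_subfunctor_zclosure B X :
    (forall (V W : finType) (f : W -> V -> K) x, X V x -> X W (act (blockm f) x)) ->
    (forall V x b, X V x -> b \in B V -> X V (x + b)) ->
  closed_subfunctor B (fun V => zclosure (@X V)).
Proof.
move=> X_act X_B; split=> [V|V W f x|V x b clx bB]; first exact: zclosed_zclosure.
  apply: zclosure_image => [p|y Xy]; first exact: polyfun_act_comp.
  exact/sub_zclosure/X_act.
apply: (zclosure_image (L := fun x => x + b)) clx => [p|y Xy]; first exact: polyfun_translate.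
exact/sub_zclosure/X_B.
Qed.

Lemma chain_decr2 (X : nat -> forall V : finType, tens (U + V)%type -> Prop) :
    (forall n V x, X n.+1 V x -> X n V x) ->
  forall m n V x, (m <= n)%N -> X n V x -> X m V x.
Proof.
by move=> X_decr m n V x mn; apply: (@chain_decr _ (fun n => X n V)) => // k y; apply: X_decr.
Qed.

(** Composing an equation with a projection [pr] along [B V] makes it invariant under [B V], and
    [X V] is stable under [pr]. *)
Lemma closed_subfunctor_separates B X V x : closed_subfunctor B X -> ~ X V x ->
  exists f, [/\ polyfun f, forall y b, b \in B V -> f (y + b) = f y,
    forall y, X V y -> f y = 0 & f x != 0].
Proof.
move=> [X_cl _ X_B] nXx.
have [n [y [l [_ l_lin lB _ y_span]]]] := relative_basis (B V) {:tens (U + V)%type}.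
pose pr z := \sum_i l i z *: y i.
have pr_lin : linear pr.
  move=> a u v; rewrite scaler_sumr -big_split /=; apply: eq_bigr => i _.
  by rewrite l_lin scalerDl scalerA.
have prB z : z - pr z \in B V by apply: y_span; apply: memvf.
have Xpr z : X V (pr z) <-> X V z.
  split=> Xz; first by rewrite -(subrK (pr z) z) addrC; apply: X_B.
  by rewrite -[pr z](subKr z); apply: X_B => //; rewrite memvN.
have nXpr : ~ X V (pr x) by move=> /Xpr.
have [p [p_pol pX px]] := nzclosed_witness (X_cl V) nXpr.
exists (fun z => p (pr z)); split=> [|z b bB|z /Xpr/pX//|//].
  exact: polyfun_comp_lin.
congr p; apply: eq_bigr => i _; rewrite scalarfD // [l i b](lB i b bB).
by rewrite addr0.
Qed.

Lemma closed_subfunctor_ind B (Q : (forall V : finType, tens (U + V)%type -> Prop) -> Prop) :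
    noetherian_mod B ->
    (forall Z, closed_subfunctor B Z ->
       (forall Z', closed_subfunctor B Z' -> (forall V x, Z' V x -> Z V x) ->
          (exists V x, Z V x /\ ~ Z' V x) -> Q Z') -> Q Z) ->
  forall Z, closed_subfunctor B Z -> Q Z.
Proof.
move=> B_noeth Q_ind Z Z_csub; apply: NNPP => nQZ.
pose bad := {Z | closed_subfunctor B Z /\ ~ Q Z}.
have next (Z1 : bad) : exists Z2 : bad, (forall V x, sval Z2 V x -> sval Z1 V x) /\
    exists V x, sval Z1 V x /\ ~ sval Z2 V x.
  case: Z1 => Z1 [Z1_csub nQZ1]; apply: NNPP => no_next; apply: (nQZ1).
  apply: Q_ind => // Z2 Z2_csub Z21 Z21'; apply: NNPP => nQZ2.
  by apply: no_next; exists (exist _ Z2 (conj Z2_csub nQZ2)).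
have [nx nxP] := dependent_choice next.
pose Zs n := iter n nx (exist _ Z (conj Z_csub nQZ)).
have [||N ZN] := B_noeth (fun n => sval (Zs n)).
- by move=> n; case: (svalP (Zs n)).
- by move=> n V x; apply: (nxP (Zs n)).1.
have [V [x [Zx nZx]]] := (nxP (Zs N)).2; apply: nZx.
exact: (ZN N.+1).
Qed.

Section Twist.
Variable q : nat.
Hypothesis q_frob : frobenius_exponent K q.

Lemma frobmap_act_blockm (V W : finType) (f : W -> V -> K) (x : tens (U + V)%type) :
  frobmap q (act (blockm f) x) = act (blockm (fun a b => f a b ^+ q)) (frobmap q x).
Proof.
rewrite frobmap_act //; congr (act _ _); apply: functional_extensionality => -[a|a];
  apply: functional_extensionality => -[b|b] //=.
- by case: eqP => _; rewrite ?expr1n // expr0n eqn0Ngt q_frob.1.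
- by rewrite expr0n eqn0Ngt q_frob.1.
- by rewrite expr0n eqn0Ngt q_frob.1.
Qed.

(** Frobenius intertwines [act f] only with matrices of [q]-th powers; density extends the resulting
    identities to all matrices. *)
Lemma act_frobmap_dense (V W : finType) (p : tens (U + W)%type -> K) (x : tens (U + V)%type) :
    polyfun p -> (forall f : W -> V -> K, p (act (blockm (fun a b => f a b ^+ q)) x) = 0) ->
  forall f : W -> V -> K, p (act (blockm f) x) = 0.
Proof.
move=> p_pol p0 f.
pose u (m : {ffun W * V -> K^o}) := p (act (blockm (fun a b => m (a, b) : K)) x).
have u_pol : polyfun u.
  apply: polyfun_act => // -[a|a] [b|b] /=; try exact: polyfun_const.
  exact: polyfun_coordinate.
have -> : p (act (blockm f) x) = u [ffun ab => f ab.1 ab.2].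
  congr (p (act (blockm _) _)); apply: functional_extensionality => a.
  by apply: functional_extensionality => b; rewrite ffunE.
apply: (frobmap_dense hK q_frob) => // m; rewrite -(p0 (fun a b => m (a, b))).
congr (p (act (blockm _) _)); apply: functional_extensionality => a.
by apply: functional_extensionality => b; rewrite ffunE.
Qed.

Lemma frobspan_ind (J : finType) (S : {vspace {ffun J -> K^o}}) (Q : {ffun J -> K^o} -> Prop) :
    Q 0 -> (forall a x y, Q x -> Q y -> Q (a *: x + y)) ->
    (forall x, x \in S -> Q (frobmap q x)) ->
  forall x, x \in frobspan q S -> Q x.
Proof.
move=> Q0 Q_lin QS x; have [T TE] := vspace_of_pred Q0 Q_lin.
by move=> xS; apply/TE; apply: subvP x xS; apply: frobspan_sub => y yS; apply/TE/QS.
Qed.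

Lemma subfunctor_frobspan B : subfunctor B -> subfunctor (fun V => frobspan q (B V)).
Proof.
move=> B_sub V W f x; apply: (frobspan_ind (Q := fun x => act (blockm f) x \in frobspan q (B W))).
- by rewrite act0 mem0v.
- by move=> a y z yB zB; rewrite act_linear memvD ?memvZ.
move=> {}x xB; apply: contraT => xB'.
have [g [g_lin gB /eqP[]]] := scalar_separates xB'.
apply: act_frobmap_dense => [|h]; first exact: polyfun_lin.
by rewrite -frobmap_act_blockm; apply: gB; apply: mem_frobspan => //; apply: B_sub.
Qed.

(** A chain is carried to the closures of its images under [frobmap q]. Nothing is lost, since
    [p ^+ q] factors through [frobmap q] for each polynomial function [p], so an equation of the
    original set yields one of the image. *)
Lemma noetherian_mod_frobspan B : noetherian_mod (fun V => frobspan q (B V)) -> noetherian_mod B.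
Proof.
move=> tw_noeth X X_csub X_decr.
pose twX n (V : finType) (y : tens (U + V)%type) := exists2 x, X n V x & y = frobmap q x.
(* Translation by [a *: frobmap q b] clearly preserves the image when [a] is a [q]-th power; the
   other [a] follow because a polynomial in [a] is determined on these. *)
have tw_poly n (V : finType) (p : tens (U + V)%type -> K) y b a :
    polyfun p -> (forall z, twX n V z -> p z = 0) ->
    twX n V y -> b \in B V -> p (y + a *: frobmap q b) = 0.
  move=> p_pol pX [x Xx ->] bB.
  have [P PE] := polyfam_curve (frobmap q x) (polyfam_line (frobmap q b)) p_pol.
  suff P0 : P = 0 by rewrite PE P0 horner0.
  apply: (poly_inj_eq0 hK (frob_inj q_frob)) => c /=.
  rewrite -PE -frobmapZ -frobmapD //; apply: pX; exists (x + c *: b) => //.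
  by have [_ _ X_B] := X_csub n; apply: X_B => //; apply: memvZ.
have [||N XN] := tw_noeth (fun n V => zclosure (@twX n V)).
- move=> n; have [X_cl X_act X_B] := X_csub n; split=> [V|V W f x|V x b clx bB].
  + exact: zclosed_zclosure.
  + apply: zclosure_image => [p|_ [y Xy ->]]; first exact: polyfun_act_comp.
    move=> p p_pol pX; apply: act_frobmap_dense => // g.
    by rewrite -frobmap_act_blockm; apply: pX; exists (act (blockm g) y) => //; apply: X_act.
  suff : forall a x, zclosure (@twX n V) x -> zclosure (@twX n V) (x + a *: b).
    by move=> /(_ 1 _ clx); rewrite scale1r.
  apply: (frobspan_ind (Q := fun b => forall a x,
    zclosure (@twX n V) x -> zclosure (@twX n V) (x + a *: b))) bB => {clx x b}.
  + by move=> a x; rewrite scaler0 addr0.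
  + move=> a b c Qb Qc a' x clx; rewrite scalerDr scalerA addrA.
    exact/Qc/Qb.
  + move=> b bB a x; apply: (zclosure_image (L := fun x => x + a *: frobmap q b)) => [p|y Xy].
      exact: polyfun_translate.
    by move=> p p_pol pX; apply: (tw_poly n).
- move=> n V x; apply: zclosure_mono => _ [y Xy ->]; exists y => //; exact: X_decr.
exists N => n V x Nn XNx; have [X_cl _ _] := X_csub n; apply: X_cl => p p_pol pX.
have [h h_pol hE] := polyfun_frobmap q_frob p_pol.
suff : p x ^+ q == 0 by rewrite expf_eq0 q_frob.1 => /eqP.
rewrite -hE; apply/eqP; apply: (XN n V (frobmap q x)) => // [|_ [y Xy ->]].
  by apply: sub_zclosure; exists x.
by rewrite hE pX // expr0n eqn0Ngt q_frob.1.
Qed.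

End Twist.

(** Modulo [B] only the part of degree 0 is left. The zero maps to and from [void] preserve it, so
    the whole chain is governed by its value at [void]. *)
Lemma noetherian_mod_deg1 B : (forall V x, deg_ge 1 x -> x \in B V) -> noetherian_mod B.
Proof.
move=> B1 X X_csub X_decr.
pose z (V W : finType) (a : W) (b : V) : K := 0.
have z_act V W x : act (blockm (@z W V)) (act (blockm (@z V W)) x) - x \in B V.
  apply: B1 => w; rewrite ltnS leqn0 sum_nat_eq0 => /forallP wl.
  rewrite act_comp mulm_blockm ffunBE (act_pull _ (g := w)) ?subrr // => i b.
  have := wl i; rewrite eqb0; case: (w i) b => [u|v] // [u'|v'] _ //=.
  by rewrite eq_sym.
have [||N XN] := @zclosed_dcc K {ffun {ffun I -> (U + void)%type} -> K^o} (fun n => X n void).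
- by move=> n; have [X_cl _ _] := X_csub n; apply: X_cl.
- by move=> n x; apply: X_decr.
exists N => n V x Nn XNx; have [_ XN_act _] := X_csub N; have [_ X_act X_B] := X_csub n.
rewrite -(subKr (act (blockm (@z void V)) (act (blockm (@z V void)) x)) x).
apply: X_B; last by rewrite memvN; apply: z_act.
by apply: X_act; apply: XN => //; apply: XN_act.
Qed.

End FixU.
End ClosedSubfunctors.

(** * Leading directional coefficients *)

Section LeadingDirectionalCoefficient.
Variables (K : fieldType) (E : vectType K).
Hypothesis hK : infinite K.

Definition dircoef (f : E -> K) k (x r : E) : K := coefT (fun t => f (x + t *: r)) k.

Lemma dircoefZ (f : E -> K) k x r c : polyfun f ->
  dircoef f k x (c *: r) = c ^+ k * dircoef f k x r.
Proof.
move=> f_pol; have [p pE] := polyfam_curve x (polyfam_line r) f_pol.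
rewrite /dircoef (coefTE hK k pE) (@coefTE _ hK _ (\poly_(i < size p) (c ^+ i * p`_i))).
  by rewrite coef_poly; case: ltnP => // /(nth_default 0)->; rewrite mulr0.
move=> t; rewrite scalerA pE horner_poly horner_coef; apply: eq_bigr => i _.
by rewrite exprMn mulrA mulrC mulrA.
Qed.

Variables (f : E -> K) (Z : E -> Prop) (R : {vspace E}) (q : nat).
Hypotheses (f_pol : polyfun f) (ZR : forall x r, Z x -> r \in R -> Z (x + r)).
Hypotheses (q_gt0 : (0 < q)%N)
  (low : forall x r k, Z x -> r \in R -> (0 < k < q)%N -> dircoef f k x r = 0).

(* With [P] the expansion of [f (A t + s *: r)] in powers of [s] over [K[t]], substituting
   [s := t ^+ d] moves [P`_k] up by [d * k], so only [k = 0] and [k = q] reach degree [d * q]. *)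
Lemma coefT_curve_shift (A : K -> E) (r : E) d :
    polycurve A -> (forall t, Z (A t)) -> r \in R -> (0 < d)%N ->
  coefT (fun t => f (A t + t ^+ d *: r)) (d * q) =
  coefT (fun t => f (A t)) (d * q) + dircoef f q (A 0) r.
Proof.
move=> A_pol AZ rR d_gt0.
have [P PE] : exists P : {poly {poly K}}, forall s t, f (A t + s *: r) = P.[s%:P].[t].
  move: f_pol; elim/polyfun_ind => [c|g g_lin|g h [P PE] [Q QE]|g h [P PE] [Q QE]].
  - by exists c%:P%:P => s t; rewrite !hornerC.
  - have [p pE] := A_pol g (polyfun_lin g_lin).
    exists (p%:P + (g r)%:P%:P * 'X) => s t.
    by rewrite scalarfD // scalarfZ // pE !hornerE mulrC.
  - by exists (P + Q) => s t; rewrite hornerD hornerD PE QE.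
  - by exists (P * Q) => s t; rewrite hornerM hornerM PE QE.
have P_horner t (Q : {poly K}) : (map_poly (horner_eval t) P).[Q.[t]] = P.[Q].[t].
  exact: (horner_map (horner_eval t) P Q).
have P_coef k t : dircoef f k (A t) r = (P`_k).[t].
  rewrite /dircoef (@coefTE _ hK _ (map_poly (horner_eval t) P)) ?coef_map // => s.
  by rewrite PE -P_horner hornerC.
have P_low k : (0 < k < q)%N -> P`_k = 0.
  by move=> kq; apply: (poly_funext hK) => t; rewrite -P_coef low // horner0.
rewrite (@coefTE _ hK _ P.['X^d]) => [|t]; last first.
  by rewrite PE -!P_horner hornerC hornerXn.
rewrite (@coefTE _ hK _ P`_0) => [|t]; last first.
  by rewrite -[A t]addr0 -(scale0r r) PE polyC0 horner_coef0.
rewrite P_coef horner_coef0 (horner_coef_wide _ (leq_addr q.+1 (size P))) coef_sum.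
have q_lt : (q < size P + q.+1)%N by rewrite addnS ltnS leq_addl.
have p_lt : (0 < size P + q.+1)%N by rewrite addnS.
rewrite (bigD1 (Ordinal p_lt)) //= expr0 mulr1 (bigD1 (Ordinal q_lt)) //=; last first.
  by rewrite -val_eqE /= -lt0n.
rewrite -exprM coefMXn ltnn subnn big1 ?addr0 // => k /andP[k0 kq].
have [lt_kq|le_qk] := ltnP k q; first by rewrite P_low ?mul0r ?coef0 // lt_kq lt0n k0.
have lt_qk : (q < k)%N by rewrite ltn_neqAle le_qk eq_sym kq.
by rewrite -exprM coefMXn ltn_pmul2l // lt_qk.
Qed.

(** The shift formula with exponent 1 along the line [x + t *: r], whose value at 0 is [x]. *)
Lemma dircoefD x r s : Z x -> r \in R -> s \in R ->
  dircoef f q x (r + s) = dircoef f q x r + dircoef f q x s.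
Proof.
move=> Zx rR sR.
have := @coefT_curve_shift (fun t => x + t *: r) s 1.
rewrite mul1n scale0r addr0 => <- //.
- by congr coefT; apply: functional_extensionality => t; rewrite scalerDr addrA.
- exact: (polyfam_curve x (polyfam_line r)).
- by move=> t; apply: ZR => //; apply: memvZ.
Qed.

Lemma dircoef0 x : dircoef f q x 0 = 0.
Proof. by rewrite -(scale0r 0) dircoefZ // expr0n eqn0Ngt q_gt0 mul0r. Qed.

Lemma dircoef_sum (J : finType) (F : J -> E) x : Z x -> (forall j, F j \in R) ->
  dircoef f q x (\sum_j F j) = \sum_j dircoef f q x (F j).
Proof.
move=> Zx FR.
suff : dircoef f q x (\sum_j F j) = \sum_j dircoef f q x (F j) /\ \sum_j F j \in R by case.
elim/big_rec2: _ => [|j a b _ [<- bR]]; first by rewrite dircoef0 mem0v.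
by rewrite dircoefD // memvD.
Qed.

Lemma dircoef_frob x r : Z x -> r \in R -> dircoef f q x r != 0 -> frobenius_exponent K q.
Proof.
move=> Zx rR fr; split=> // a b; apply: (mulIf fr).
by rewrite mulrDl -!dircoefZ // scalerDl dircoefD ?memvZ.
Qed.

End LeadingDirectionalCoefficient.

(** * Elimination *)

Lemma polyfun_det (K : fieldType) (E : vectType K) n (M : E -> 'M[K]_n) :
  (forall i j, polyfun (fun x => M x i j)) -> polyfun (fun x => \det (M x)).
Proof.
move=> M_pol; apply: polyfun_sum => s; apply: polyfunM; first exact: polyfun_const.
exact: polyfun_prod.
Qed.

Lemma polyfun_adj (K : fieldType) (E : vectType K) n (M : E -> 'M[K]_n) i j :
  (forall i j, polyfun (fun x => M x i j)) -> polyfun (fun x => \adj (M x) i j).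
Proof.
move=> M_pol; under eq_fun => x do rewrite mxE /cofactor.
apply: polyfunM; first exact: polyfun_const.
by apply: polyfun_det => k l; under eq_fun => x do rewrite !mxE.
Qed.

Section Elimination.
Variables (K : fieldType) (I : finType).
Hypothesis hK : infinite K.
Local Notation tens L := {ffun {ffun I -> L} -> K^o}.

Definition inrm (W V : finType) (a : W + V) (v : V) : K :=
  if a is inr v' then (v' == v)%:R else 0.
Definition prr (W V : finType) (v : V) (b : W + V) : K :=
  if b is inr v' then (v == v')%:R else 0.
Definition prl (W V : finType) (w : W) (b : W + V) : K :=
  if b is inl w' then (w == w')%:R else 0.
(** At [t = 0] this is the projection to [W], and on tensors of degree [d] coming from [V] it acts
    as [t ^+ d] times [f]; the power of [t] thus isolates the contribution of [R V]. *)
Definition pencil (W V : finType) (f : W -> V -> K) t (w : W) (b : W + V) : K :=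
  match b with inl w' => (w == w')%:R | inr v => t * f w v end.

Lemma mulm_inrm (W V X : finType) (f : X -> (W + V)%type -> K) :
  mulm f (@inrm W V) = fun x v => f x (inr v).
Proof.
apply: functional_extensionality => x; apply: functional_extensionality => v.
rewrite /mulm big_sumType /= big1 ?add0r => [|w _]; last by rewrite mulr0.
rewrite (bigD1 v) //= eqxx mulr1 big1 ?addr0 // => v' /negPf->.
by rewrite mulr0.
Qed.

Lemma pencil0 (W V : finType) (f : W -> V -> K) : pencil f 0 = @prl W V.
Proof.
apply: functional_extensionality => w; apply: functional_extensionality => -[w'|v] //=.
exact: mul0r.
Qed.

(** All Frobenius twists of the quotient [(B + R) / B] are irreducible; over an imperfect field
    this is stronger than irreducibility of the quotient itself. *)
Definition twist_irreducible (U : finType) (B R : forall V : finType, {vspace tens (U + V)%type}) :=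
  forall q, frobenius_exponent K q -> forall N : forall V : finType, {vspace tens (U + V)%type},
    subfunctor N -> (forall V, (N V <= frobspan q (R V))%VS) ->
    (exists V, ~~ (N V <= frobspan q (B V))%VS) ->
    forall V, (frobspan q (R V) <= N V + frobspan q (B V))%VS.

Variables (U : finType) (d : nat).
Hypothesis d_gt0 : (0 < d)%N.
Variables B R : forall V : finType, {vspace tens (U + V)%type}.
Hypotheses (B_sub : subfunctor B) (R_sub : subfunctor R).
Hypothesis R_deg : forall V x, x \in R V -> pure_deg d x.

Hypothesis R_irr : twist_irreducible B R.

Lemma polyfam_pencil (W V : finType) (f : W -> V -> K) :
  polyfam (fun (x : tens (U + (W + V))%type) t => act (blockm (pencil f t)) x).
Proof.
pose f1 (a : U + W) (b : U + (W + V)) : K :=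
  match a, b with inr w, inr (inr v) => f w v | _, _ => 0 end.
have -> : (fun (x : tens (U + (W + V))%type) t => act (blockm (pencil f t)) x) =
    (fun x t => act (fun a b => blockm (@prl W V) a b + t * f1 a b) x).
  apply: functional_extensionality => x; apply: functional_extensionality => t.
  congr act; apply: functional_extensionality => -[u|w];
    by apply: functional_extensionality => -[u'|[w'|v]] //=; rewrite ?mulr0 ?addr0 ?add0r.
exact: polyfam_act.
Qed.

Section Step.
Variables (W : finType) (f : tens (U + W)%type -> K) (q : nat).
Variables Z X : forall V : finType, tens (U + V)%type -> Prop.
Arguments Z : clear implicits.
Arguments X : clear implicits.
Hypotheses (Z_csub : closed_subfunctor (fun V => B V + R V)%VS Z) (X_csub : closed_subfunctor B X).
Hypotheses (XZ : forall V x, X V x -> Z V x).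
Hypotheses (f_pol : polyfun f) (f_B : forall x b, b \in B W -> f (x + b) = f x).
Hypotheses (fX : forall x, X W x -> f x = 0).
Hypotheses (q_gt0 : (0 < q)%N).
Hypothesis low : forall x r k, Z W x -> r \in (B W + R W)%VS -> (0 < k < q)%N ->
  dircoef f k x r = 0.
Variables (r0 : tens (U + W)%type) (r0R : r0 \in R W).

Let ZBR x r : Z W x -> r \in (B W + R W)%VS -> Z W (x + r).
Proof. by case: Z_csub => _ _; apply. Qed.

Lemma dircoef_B x b : b \in B W -> dircoef f q x b = 0.
Proof.
move=> bB; rewrite /dircoef (@coefTE _ hK _ (f x)%:P) => [|t].
  by rewrite coefC eqn0Ngt q_gt0.
by rewrite hornerC f_B // memvZ.
Qed.

(* [dircoef f q x] is additive and [q]-semilinear, so it extends to a linear form [Lam] on the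
   twist; the tensors all of whose images are killed by [Lam] form a subfunctor, which by
   irreducibility is contained in the twist of [B]. *)
Lemma full_rank (V : finType) x n (y : 'I_n -> tens (U + V)%type)
    (l : 'I_n -> tens (U + V)%type -> K) :
    Z W x -> dircoef f q x r0 != 0 ->
    (forall i, y i \in R V) -> (forall i, scalar (l i)) ->
    (forall i b, b \in B V -> l i b = 0) -> (forall i j, l i (y j) = (i == j)%:R) ->
  exists psi : 'I_n -> W -> V -> K,
    (\matrix_(j, i) dircoef f q x (act (blockm (psi j)) (y i))) \in unitmx.
Proof.
move=> Zx fr0 yR l_lin lB ly.
have BR_R r : r \in R W -> r \in (B W + R W)%VS by apply/subvP/addvSr.
have q_frob : frobenius_exponent K q.
  exact: (dircoef_frob hK f_pol ZBR q_gt0 low Zx (BR_R _ r0R) fr0).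
have [Lam Lam_lin LamE] : exists2 Lam : tens (U + W)%type -> K, scalar Lam &
    forall r, r \in (B W + R W)%VS -> Lam (frobmap q r) = dircoef f q x r.
  have [m [z [k [z_BR k_lin kB _ z_span]]]] := relative_basis (B W) (B W + R W).
  have [h hP] : exists h : 'I_m -> tens (U + W)%type -> K,
      forall i, scalar (h i) /\ forall r, h i (frobmap q r) = k i r ^+ q.
    apply: (dependent_choice (Q := fun i h =>
      scalar h /\ forall r, h (frobmap q r) = k i r ^+ q)) => i.
    by have [h] := scalar_frobmap q_frob (k_lin i); exists h.
  exists (fun v => \sum_i dircoef f q x (z i) * h i v) => [a u v|r rBR].
    rewrite mulr_sumr -big_split /=; apply: eq_bigr => i _.
    by rewrite (hP i).1 mulrDr mulrCA.
  have kz_BR i : k i r *: z i \in (B W + R W)%VS by apply: memvZ.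
  have bB := z_span r rBR.
  have bBR := subvP (addvSl _ (R W)) _ bB.
  rewrite -[in RHS](subrK (\sum_i k i r *: z i) r).
  rewrite (dircoefD hK f_pol ZBR q_gt0 low Zx) ?memv_suml // dircoef_B // add0r.
  rewrite (dircoef_sum hK f_pol ZBR q_gt0 low Zx) //; apply: eq_bigr => i _.
  by rewrite (hP i).2 dircoefZ // mulrC.
have Lam_twB b : b \in frobspan q (B W) -> Lam b = 0.
  apply: (frobspan_ind (Q := fun b => Lam b = 0)) => [|a u v Lu Lv|{}b bB].
  - exact: scalarf0.
  - by rewrite Lam_lin Lu Lv mulr0 addr0.
  - by rewrite LamE ?dircoef_B // (subvP (addvSl _ _) _ bB).
have [N NE] : exists N : forall V' : finType, {vspace tens (U + V')%type}, forall V' v,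
    v \in N V' <-> v \in frobspan q (R V') /\
      forall psi : W -> V' -> K, Lam (act (blockm psi) v) = 0.
  apply: (dependent_choice (Q := fun (V' : finType) (N : {vspace tens (U + V')%type}) => forall v,
    v \in N <-> v \in frobspan q (R V') /\
      forall psi : W -> V' -> K, Lam (act (blockm psi) v) = 0)) => V'.
  apply: vspace_of_pred => [|a u v [uR Lu] [vR Lv]]; split.
  - exact: mem0v.
  - by move=> psi; rewrite act0 scalarf0.
  - by rewrite memvD ?memvZ.
  - by move=> psi; rewrite act_linear Lam_lin Lu Lv mulr0 addr0.
have N_sub : subfunctor N.
  move=> V1 V2 g v /NE[vR Lv]; apply/NE; split=> [|psi].
    exact: (subfunctor_frobspan hK q_frob R_sub).
  by rewrite act_comp mulm_blockm.
have N_R V' : (N V' <= frobspan q (R V'))%VS by apply/subvP => v /NE[].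
(* Otherwise irreducibility puts the twist of [R W] into [N W] plus the twist of [B W]; [Lam]
   vanishes on both, against [fr0]. *)
have N_B V' : (N V' <= frobspan q (B V'))%VS.
  apply: contraT => nNB; case/eqP: fr0; rewrite -LamE ?BR_R //.
  have r0_tw := mem_frobspan q_frob r0R.
  have /subvP/(_ _ r0_tw) := R_irr q_frob N_sub N_R (ex_intro _ V' nNB) W.
  case/memv_addP => v /NE[_ Lv] [b bB ->].
  by rewrite scalarfD // (Lam_twB _ bB) addr0 -[v]act_id -blockm_id Lv.
pose P (r : 'rV[K]_n) := exists psi : W -> V -> K,
  r = \row_i dircoef f q x (act (blockm psi) (y i)).
have [|A [PA A_unit]] := @row_family_unitmx K n P; last first.
  have [psi psiE] := dependent_choice PA; exists psi.
  suff -> : \matrix_(j, i) dircoef f q x (act (blockm (psi j)) (y i)) = A by [].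
  by apply/row_matrixP => j; rewrite psiE; apply/rowP => i; rewrite !mxE.
(* A column killed by all rows gives an element [v] of the twist of [R V] lying in [N V], hence in
   the twist of [B V], where the twisted coordinate forms vanish. *)
move=> w wP; apply/colP => i; rewrite mxE.
pose v := \sum_j w j 0 *: frobmap q (y j).
have vR : v \in frobspan q (R V).
  by apply: memv_suml => j _; apply: memvZ; apply: mem_frobspan.
have vN : v \in N V.
  apply/NE; split=> //; apply: (act_frobmap_dense hK q_frob) => [|psi]; first exact: polyfun_lin.
  have /matrixP/(_ 0 0) := wP _ (ex_intro _ psi erefl); rewrite !mxE => <-.
  rewrite act_sum scalarf_sum //; apply: eq_bigr => j _.
  rewrite actZ scalarfZ // -frobmap_act_blockm // LamE; last by apply/BR_R/R_sub.
  by rewrite mxE mulrC.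
have [h h_lin hE] := scalar_frobmap q_frob (l_lin i).
have h_twB b : b \in frobspan q (B V) -> h b = 0.
  apply: (frobspan_ind (Q := fun b => h b = 0)) => [|a b1 b2 h1 h2|{}b bB].
  - exact: scalarf0.
  - by rewrite h_lin h1 h2 mulr0 addr0.
  - by rewrite hE lB // expr0n eqn0Ngt q_gt0.
have := h_twB _ (subvP (N_B V) _ vN).
rewrite /v scalarf_sum // (bigD1 i) //= big1 ?addr0 => [|j ji].
  by rewrite scalarfZ // hE ly eqxx expr1n mulr1.
by rewrite scalarfZ // hE ly eq_sym (negPf ji) expr0n eqn0Ngt q_gt0 mulr0.
Qed.

Section Fibre.
Variable V : finType.
Local Notation iota := (act (blockm (@inrm W V))).
Local Notation base := (act (blockm (@prl W V))).

Let X_base x : X (W + V)%type x -> X W (base x).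
Proof. by case: X_csub => _ X_act _; apply: X_act. Qed.

Lemma base_iota r : r \in R V -> base (iota r) = 0.
Proof.
move=> rR; rewrite act_comp mulm_blockm mulm_inrm /=.
have -> : (fun (_ : W) (_ : V) => 0 : K) = (fun a b => 0 * (fun _ _ => 0) a b).
  by do 2!apply: functional_extensionality => ?; rewrite mul0r.
by rewrite (act_scale _ _ (R_deg rR)) expr0n eqn0Ngt d_gt0 scale0r.
Qed.

(** The pencil sends [x] to a curve inside [X W], on which [f] vanishes, so only the directional
    term of [coefT_curve_shift] remains. *)
Lemma shifted_coef (psi : W -> V -> K) x r : X (W + V)%type x -> r \in R V ->
  coefT (fun t => f (act (blockm (pencil psi t)) (x + iota r))) (d * q) =
  dircoef f q (base x) (act (blockm psi) r).
Proof.
move=> Xx rR; have [_ X_act _] := X_csub.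
have A_X t : X W (act (blockm (pencil psi t)) x) by apply: X_act.
have psi_r : act (blockm psi) r \in (B W + R W)%VS.
  by apply: (subvP (addvSr _ _)); apply: R_sub.
have := coefT_curve_shift hK f_pol q_gt0 low (polyfam_curve x (polyfam_pencil psi))
  (fun t => XZ (A_X t)) psi_r d_gt0.
rewrite pencil0 [X in _ = X + _](@coefTE _ hK _ 0) => [|t]; last by rewrite fX ?horner0.
rewrite coef0 add0r => <-; congr coefT; apply: functional_extensionality => t.
by rewrite actD act_comp mulm_blockm mulm_inrm -(act_scale _ _ (R_deg rR)).
Qed.

(* On [X] the equations [shifted_coef] determine the [q]-th powers of the coordinates along [R V]
   as rational functions of the remaining coordinates, with denominator [D]; hence the [q]-th power
   of any polynomial [p] agrees on [X], up to a power of [D], with one that is invariant under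
   translation by [R V]. *)
Lemma elimination C x : closed_subfunctor B C -> (forall z, C (W + V)%type z -> X (W + V)%type z) ->
    X (W + V)%type x -> dircoef f q (base x) r0 != 0 ->
    zclosure (fun z => exists c r, [/\ C (W + V)%type c, r \in R V & z = c + iota r]) x ->
  C (W + V)%type x.
Proof.
move=> [C_cl _ C_B] CX Xx fr0 clx.
have Zx := XZ (X_base Xx).
have BR_R r : r \in R W -> r \in (B W + R W)%VS by apply/subvP/addvSr.
have q_frob : frobenius_exponent K q.
  exact: (dircoef_frob hK f_pol ZBR q_gt0 low Zx (BR_R _ r0R) fr0).
have [n [y [l [yR l_lin lB ly y_span]]]] := relative_basis (B V) (R V).
have [psi M_unit] := full_rank Zx fr0 yR l_lin lB ly.
pose M z := \matrix_(j, i) dircoef f q (base z) (act (blockm (psi j)) (y i)).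
pose comb a := iota (\sum_i a i *: y i).
have sumR (a : 'I_n -> K) : \sum_i a i *: y i \in R V.
  by apply: memv_suml => i _; apply: memvZ.
pose c i z := l i (act (blockm (@prr W V)) z).
have c_lin i : scalar (c i) by apply: scalar_comp => //; apply: act_linear.
have c_comb i a : c i (comb a) = a i.
  rewrite /c /comb act_comp mulm_blockm mulm_inrm /= -[X in blockm X]/(@idm K V) blockm_id act_id.
  rewrite scalarf_sum // (bigD1 i) //= scalarfZ // ly eqxx mulr1 big1 ?addr0 // => j ji.
  by rewrite scalarfZ // ly eq_sym (negPf ji) mulr0.
(* [red] removes the component along the chosen basis of [R V], which makes every function of
   [red z] invariant. *)
pose red z := z - comb (fun i => c i z).
have red_lin : linear red.
  move=> a u v; rewrite /red /comb !act_sum scalerBr addrACA -opprD scaler_sumr -big_split.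
  congr (_ - _); apply: eq_bigr => i _.
  by rewrite !actZ c_lin scalerDl scalerA.
pose inv (g : tens (U + (W + V))%type -> K) := forall z a, g (z + comb a) = g z.
have red_inv z a : red (z + comb a) = red z.
  rewrite /red.
  have -> : comb (fun i => c i (z + comb a)) = comb (fun i => c i z) + comb a.
    rewrite /comb -actD -big_split; congr (act _ _); apply: eq_bigr => i _ /=.
    by rewrite scalarfD // c_comb scalerDl.
  by rewrite opprD addrACA subrr addr0.
have M_inv z a : M (z + comb a) = M z.
  by apply/matrixP => i j; rewrite !mxE actD base_iota ?sumR // addr0.
have M_pol i j : polyfun (fun z => M z i j).
  under eq_fun => z do rewrite mxE.
  apply: (@polyfun_act_comp K I _ _ _ (fun z => dircoef f q z (act (blockm (psi i)) (y j)))).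
  exact: (polyfam_coefT hK q (polyfam_line _) f_pol).
pose G j z := coefT (fun t => f (act (blockm (pencil (psi j) t)) (red z))) (d * q).
pose D z := \det (M z).
(* Cramer's rule: [H i] is the numerator of the [q]-th power of the [i]-th coordinate. *)
pose H i z := \sum_j \adj (M z) i j * - G j z.
have H_inv i : inv (H i) by move=> z a; rewrite /H /G M_inv red_inv.
have D_inv : inv D by move=> z a; rewrite /D M_inv.
have D_pol : polyfun D by apply: polyfun_det.
have H_pol i : polyfun (H i).
  apply: polyfun_sum => j; apply: polyfunM; first exact: polyfun_adj.
  apply: polyfunN; apply: (polyfun_comp_lin red_lin (f := fun z =>
    coefT (fun t => f (act (blockm (pencil (psi j) t)) z)) (d * q))).
  exact: (polyfam_coefT hK _ (polyfam_pencil _) f_pol).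
have DH i z : X (W + V)%type z -> D z * c i z ^+ q = H i z.
  move=> Xz.
  (* [red z] is [z] translated by minus its component along [R V], so [shifted_coef] applies; the
     sign passes through the [q]-th powers because these are additive. *)
  have Mc : M z *m (\col_i c i z ^+ q) = \col_j (- G j z).
    apply/matrixP => j k; rewrite !mxE /G /red /comb -actN.
    rewrite shifted_coef ?memvN ?sumR //.
    rewrite -scaleN1r scaler_sumr act_sum.
    rewrite (dircoef_sum hK f_pol ZBR q_gt0 low (XZ (X_base Xz))) => [|m]; last first.
      by rewrite !actZ !memvZ // BR_R // R_sub.
    rewrite -sumrN; apply: eq_bigr => m _; rewrite !mxE !actZ scalerA.
    rewrite mulN1r dircoefZ // mulrC -mulNr; congr (_ * _).
    by apply/eqP; rewrite -addr_eq0 -q_frob.2 subrr expr0n eqn0Ngt q_gt0.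
  have := congr1 (mulmx (\adj (M z))) Mc; rewrite mulmxA mul_adj_mx mul_scalar_mx.
  move=> /matrixP/(_ i 0); rewrite 2![in LHS]mxE /D => ->; rewrite mxE.
  by apply: eq_bigr => j _; congr (_ * _); rewrite mxE.
have p_cl_aux : forall p, polyfun p -> exists N p', [/\ polyfun p', inv p' &
    forall z, X (W + V)%type z -> p' z = D z ^+ N * p z ^+ q].
  move=> p; elim/polyfun_ind => [e|g g_lin|g h [N [g' [g'p g'i g'E]]] [N' [h' [h'p h'i h'E]]]
                               |g h [N [g' [g'p g'i g'E]]] [N' [h' [h'p h'i h'E]]]].
  - exists 0%N, (fun=> e ^+ q); split=> // [|z _]; first exact: polyfun_const.
    by rewrite mul1r.
  (* Split [g z] along [z = red z + comb (c z)], raise it to the power [q], multiply by [D z] and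
     replace each [D z * c i z ^+ q] by [H i z]. *)
  - pose g' z := D z * g (red z) ^+ q + \sum_i H i z * g (iota (y i)) ^+ q.
    exists 1%N, g'; split=> [|z a|z Xz].
    + apply: polyfunD; last first.
        by apply: polyfun_sum => i; apply: polyfunM => //; apply: polyfun_const.
      apply: polyfunM => //; apply: polyfunX.
      exact: (polyfun_comp_lin red_lin (polyfun_lin g_lin)).
    + rewrite /g' D_inv red_inv; congr (_ + _); apply: eq_bigr => i _.
      by rewrite H_inv.
    + have -> : g z = g (red z) + g (comb (fun i => c i z)) by rewrite -scalarfD // subrK.
      rewrite expr1 q_frob.2 mulrDr; congr (_ + _).
      rewrite /comb act_sum scalarf_sum // frob_sum // mulr_sumr; apply: eq_bigr => i _.
      by rewrite actZ scalarfZ // exprMn mulrA DH.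
  - exists (N + N')%N, (fun z => D z ^+ N' * g' z + D z ^+ N * h' z); split=> [|z a|z Xz].
    + by apply: polyfunD; apply: polyfunM => //; apply: polyfunX.
    + by rewrite D_inv g'i h'i.
    + by rewrite g'E // h'E // q_frob.2 mulrDr !mulrA -!exprD [(N' + N)%N]addnC.
  - exists (N + N')%N, (fun z => g' z * h' z); split=> [|z a|z Xz].
    + exact: polyfunM.
    + by rewrite g'i h'i.
    + by rewrite g'E // h'E // exprMn exprD mulrACA.
apply: C_cl => p p_pol pC.
have [N [p' [p'_pol p'_inv p'E]]] := p_cl_aux p p_pol.
have p'x : p' x = 0.
  apply: clx => // _ [e [r [Ce rR ->]]].
  rewrite -(subrK (\sum_i l i r *: y i) r) actD addrA p'_inv.
  (* Up to an element of [B V], which [C] absorbs, [r] is a combination of the [y i], to which [p']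
     is blind. *)
  have Ceb : C (W + V)%type (e + iota (r - \sum_i l i r *: y i)).
    by apply: C_B => //; apply: B_sub; apply: y_span.
  by rewrite p'E ?pC ?expr0n ?eqn0Ngt ?q_gt0 ?mulr0 //; apply: CX.
move/eqP: p'x; rewrite p'E // mulf_eq0 !expf_eq0 q_gt0 => /orP[/andP[_ /eqP Dx]|/eqP//].
by move: M_unit; rewrite unitmxE -/(M x) -/(D x) Dx unitr0.
Qed.

End Fibre.
End Step.
End Elimination.

(** * The induction on closed subfunctors *)

Lemma nat_least (P : nat -> Prop) : (exists n, P n) ->
  exists n, P n /\ forall m, (m < n)%N -> ~ P m.
Proof.
case=> n; elim/ltn_ind: n => n IHn Pn.
have [[m mn Pm]|no_m] := classic (exists2 m, (m < n)%N & P m); first exact: IHn Pm.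
by exists n; split=> // m mn Pm; apply: no_m; exists m.
Qed.

Section Matrices.
Variable K : fieldType.

Definition funm (L L' : finType) (g : L -> L') (a : L) (b : L') : K := (g a == b)%:R.

Lemma mulm_funm (L L' L'' : finType) (g : L -> L') (X : L' -> L'' -> K) :
  mulm (funm g) X = fun a c => X (g a) c.
Proof.
apply: functional_extensionality => a; apply: functional_extensionality => c.
rewrite /mulm /funm (bigD1 (g a)) //= eqxx mul1r big1 ?addr0 // => b.
by rewrite eq_sym => /negPf->; rewrite mul0r.
Qed.

Lemma mulm_funm_can (L L' L'' : finType) (g : L -> L') (g' : L' -> L) (X : L'' -> L -> K) :
  cancel g g' -> cancel g' g -> mulm X (funm g) = fun a c => X a (g' c).
Proof.
move=> gK g'K; apply: functional_extensionality => a; apply: functional_extensionality => c.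
rewrite /mulm /funm (bigD1 (g' c)) //= g'K eqxx mulr1 big1 ?addr0 // => b bc.
by rewrite (can2_eq gK g'K) (negPf bc) mulr0.
Qed.

Definition assocf (U W V : Type) (a : U + (W + V)) : (U + W) + V :=
  match a with inl u => inl (inl u) | inr (inl w) => inl (inr w) | inr (inr v) => inr v end.
Definition unassocf (U W V : Type) (a : (U + W) + V) : U + (W + V) :=
  match a with inl (inl u) => inl u | inl (inr w) => inr (inl w) | inr v => inr (inr v) end.

Lemma assocfK (U W V : Type) : cancel (@assocf U W V) (@unassocf U W V).
Proof. by case=> [|[]]. Qed.
Lemma unassocfK (U W V : Type) : cancel (@unassocf U W V) (@assocf U W V).
Proof. by case=> [[]|]. Qed.

Definition assocm (U W V : finType) := funm (@assocf U W V).
Definition unassocm (U W V : finType) := funm (@unassocf U W V).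

Lemma assocm_blockm (U W V V' : finType) (f : V' -> V -> K) :
  mulm (@assocm U W V') (blockm (U := (U + W)%type) f) = mulm (blockm (blockm f)) (@assocm U W V).
Proof.
rewrite mulm_funm (mulm_funm_can _ (@assocfK U W V) (@unassocfK U W V)).
apply: functional_extensionality => a; apply: functional_extensionality => b.
by case: a b => [u|[w|v']] [[u'|w']|v].
Qed.

Lemma assocm_unassocm (U W V : finType) :
  mulm (@assocm U W V) (@unassocm U W V) = @idm K _.
Proof.
rewrite mulm_funm; apply: functional_extensionality => a; apply: functional_extensionality => b.
by rewrite /unassocm /funm assocfK.
Qed.

Lemma inrm_natural (W V V' : finType) (f : V' -> V -> K) :
  mulm (@inrm K W V') f = mulm (blockm f) (@inrm K W V).
Proof.
rewrite mulm_inrm; apply: functional_extensionality => a; apply: functional_extensionality => v.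
rewrite /mulm; case: a => [w|v'] /=; first by rewrite big1 // => i _; rewrite mul0r.
by rewrite (bigD1 v') //= eqxx mul1r big1 ?addr0 // => i; rewrite eq_sym => /negPf->; rewrite mul0r.
Qed.

(** The graph of [f]. It moves a point at [V] to one at [W + V] whose base is its image under [f],
    and [prr] recovers the point. *)
Definition pairm (W V : finType) (f : W -> V -> K) (b : W + V) (v : V) : K :=
  match b with inl w => f w v | inr v' => (v' == v)%:R end.

Lemma prl_pairm (W V : finType) (f : W -> V -> K) : mulm (@prl K W V) (pairm f) = f.
Proof.
apply: functional_extensionality => w; apply: functional_extensionality => v.
rewrite /mulm big_sumType /= [X in _ + X]big1 ?addr0 => [|i _]; last by rewrite mul0r.
by rewrite (bigD1 w) //= eqxx mul1r big1 ?addr0 // => i; rewrite eq_sym => /negPf->; rewrite mul0r.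
Qed.

Lemma prr_pairm (W V : finType) (f : W -> V -> K) : mulm (@prr K W V) (pairm f) = @idm K V.
Proof.
apply: functional_extensionality => v; apply: functional_extensionality => v'.
rewrite /mulm big_sumType /= big1 ?add0r => [|i _]; last by rewrite mul0r.
by rewrite (bigD1 v) //= eqxx mul1r big1 ?addr0 // => i; rewrite eq_sym => /negPf->; rewrite mul0r.
Qed.

End Matrices.

Section Induction.
Variables (K : fieldType) (I : finType).
Hypothesis hK : infinite K.
Local Notation tens L := {ffun {ffun I -> L} -> K^o}.
Variables (U : finType) (d : nat).
Hypothesis d_gt0 : (0 < d)%N.
Variables B R : forall V : finType, {vspace tens (U + V)%type}.
Hypotheses (B_sub : subfunctor B) (R_sub : subfunctor R).
Hypothesis R_deg : forall V x, x \in R V -> pure_deg d x.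
Hypothesis R_irr : twist_irreducible B R.

(** [B'] is the preimage, under reassociation of [(U + W) + V], of [B (W + V)] plus the copy of
    [R V] inside [tens (U + (W + V))]. *)
Definition shifted (W : finType) (B' : forall V : finType, {vspace tens ((U + W) + V)%type}) :=
  forall V x, x \in B' V <-> exists b r,
    [/\ b \in B (W + V)%type, r \in R V &
        act (@assocm K U W V) x = b + act (blockm (@inrm K W V)) r].

Hypothesis noethBR : noetherian_mod (fun V => B V + R V)%VS.
Hypothesis noeth_shift : forall W B', @shifted W B' -> noetherian_mod B'.

Lemma exists_shifted W : exists B', @shifted W B'.
Proof.
apply: (dependent_choice (Q := fun (V : finType) (B' : {vspace tens ((U + W) + V)%type}) =>
  forall x, x \in B' <-> exists b r,
    [/\ b \in B (W + V)%type, r \in R V &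
        act (@assocm K U W V) x = b + act (blockm (@inrm K W V)) r])) => V.
apply: vspace_of_pred => [|a x y [b [r [bB rR xE]]] [c [s [cB sR yE]]]].
  by exists 0, 0; rewrite !mem0v !act0 addr0.
exists (a *: b + c), (a *: r + s); split; rewrite ?memvD ?memvZ //.
by rewrite !act_linear xE yE scalerDr addrACA.
Qed.

Definition stable_chain (X : nat -> forall V : finType, tens (U + V)%type -> Prop) :=
  exists N, forall n V x, (N <= n)%N -> X N V x -> X n V x.

Definition closed_chain (X : nat -> forall V : finType, tens (U + V)%type -> Prop) :=
  (forall n, closed_subfunctor B (X n)) /\ (forall n V x, X n.+1 V x -> X n V x).

Lemma stable_tail k X : stable_chain (fun n => X (k + n)%N) -> stable_chain X.
Proof.
move=> [N XN]; exists (k + N)%N => n V x Nn XNx.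
have kn : (k <= n)%N by apply: leq_trans (leq_addr _ _) Nn.
by rewrite -(subnKC kn); apply: XN => //; rewrite leq_subRL.
Qed.

Lemma closed_chain_tail k X : closed_chain X -> closed_chain (fun n => X (k + n)%N).
Proof.
by move=> [X_csub X_decr]; split=> n; [apply: X_csub|rewrite addnS; apply: X_decr].
Qed.

(** Read through reassociation, the closures of [X n (W + V)] plus the copy of [R V] form a chain of
    closed subfunctors modulo [B'], which stabilises by [noeth_shift]. This supplies the closure
    hypothesis of [elimination]. *)
Lemma projection_chain (W : finType) X : closed_chain X ->
  exists N, forall n (V : finType) (x : tens (U + (W + V))%type), (N <= n)%N ->
    X N (W + V)%type x ->
    zclosure (fun z => exists c r,
      [/\ X n (W + V)%type c, r \in R V & z = c + act (blockm (@inrm K W V)) r]) x.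
Proof.
move=> [X_csub X_decr]; have [B' B'E] := exists_shifted W.
pose S n (V : finType) (z : tens (U + (W + V))%type) :=
  exists c r, [/\ X n (W + V)%type c, r \in R V & z = c + act (blockm (@inrm K W V)) r].
have [||N SN] := noeth_shift B'E
  (X := fun n (V : finType) x => zclosure (@S n V) (act (@assocm K U W V) x)).
- move=> n; have [X_cl X_act X_B] := X_csub n; split=> [V|V V' f x clx|V x b clx].
  + apply: (zclosed_preim (L := act (@assocm K U W V))); last exact: zclosed_zclosure.
    by move=> p; apply: polyfun_act_comp.
  + rewrite act_comp assocm_blockm -act_comp; apply: zclosure_image clx => [p|_ [c [r [Xc rR ->]]]].
      exact: polyfun_act_comp.
    apply: sub_zclosure; exists (act (blockm (blockm f)) c), (act (blockm f) r); split=> //.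
    * exact: X_act.
    * exact: R_sub.
    * by rewrite actD !act_comp !mulm_blockm inrm_natural.
  + case/B'E => b' [r [b'B rR bE]]; rewrite actD bE.
    apply: (zclosure_image (L := fun z => z + _)) clx => [p|_ [c [s [Xc sR ->]]]].
      exact: polyfun_translate.
    apply: sub_zclosure; exists (c + b'), (s + r); split; [exact: X_B|exact: memvD|].
    by rewrite actD addrACA.
- move=> n V x; apply: zclosure_mono => _ [c [r [/X_decr Xc rR ->]]]; by exists c, r.
exists N => n V x Nn Xx.
have := SN n V (act (@unassocm K U W V) x) Nn.
rewrite act_comp assocm_unassocm act_id; apply; apply: sub_zclosure; exists x, 0.
by rewrite mem0v act0 addr0.
Qed.

(* If [f] vanishes on [X 0] but not on [Z], its first nonzero directional coefficient [h] along
   [R] has smaller degree and does not vanish on [Z] either. The part of [X] where all pullbacks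
   of [h] vanish is handled by induction on the degree, the part where one of them does not by
   [elimination]. *)
Lemma degree_step (Z : forall V : finType, tens (U + V)%type -> Prop) :
    closed_subfunctor (fun V => B V + R V)%VS Z ->
    (forall Z', closed_subfunctor (fun V => B V + R V)%VS Z' ->
       (forall V x, Z' V x -> Z V x) -> (exists V x, Z V x /\ ~ Z' V x) ->
       forall X, closed_chain X -> (forall n V x, X n V x -> Z' V x) -> stable_chain X) ->
  forall e (W : finType) (f : tens (U + W)%type -> K), poldeg e f ->
    (forall x b, b \in B W -> f (x + b) = f x) ->
  forall X, closed_chain X -> (forall n V x, X n V x -> Z V x) ->
    (forall x, X 0%N W x -> f x = 0) -> (exists x, Z W x /\ f x != 0) -> stable_chain X.
Proof.
move=> Z_csub IHZ; elim/ltn_ind => e IHe W f f_deg f_B X X_chain XZ fX [x0 [Zx0 fx0]].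
have [X_csub X_decr] := X_chain; have f_pol : polyfun f by exists e.
have [Z_cl Z_act Z_BR] := Z_csub; have [X0_cl X0_act X0_B] := X_csub 0%N.
pose XR (V : finType) (z : tens (U + V)%type) := exists x r, [/\ X 0%N V x, r \in R V & z = x + r].
have XR_csub : closed_subfunctor (fun V => B V + R V)%VS (fun V => zclosure (@XR V)).
  apply: closed_subfunctor_zclosure => [V V' g _ [x [r [Xx rR ->]]]
                    |V _ _ [x [r [Xx rR ->]]] /memv_addP[b bB [s sR ->]]].
    exists (act (blockm g) x), (act (blockm g) r).
    by rewrite actD; split=> //; [exact: X0_act|exact: R_sub].
  exists (x + b), (r + s); rewrite addrACA memvD //; split=> //; exact: X0_B.
have XR_Z V x : zclosure (@XR V) x -> Z V x.
  move=> clx; apply: Z_cl; apply: zclosure_mono clx => _ [y [r [Xy rR ->]]].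
  by apply: Z_BR; [exact: XZ Xy|apply: (subvP (addvSr _ _))].
have [Z_neq|Z_eq] := classic (exists V x, Z V x /\ ~ zclosure (@XR V) x).
  apply: (IHZ _ XR_csub XR_Z Z_neq X X_chain) => n V x Xx.
  apply: sub_zclosure; exists x, 0; rewrite mem0v addr0; split=> //.
  exact: (chain_decr2 X_decr (leq0n n)).
have Z_XR V x : Z V x -> zclosure (@XR V) x.
  by move=> Zx; apply: NNPP => nclx; apply: Z_eq; exists V, x.
(* Otherwise [f] is constant in the directions of [R] at the points of [X 0], hence zero on
   [X 0 + R] and on its closure [Z]. *)
have ex_q : exists k, (0 < k)%N /\ exists x r,
    [/\ Z W x, r \in (B W + R W)%VS & dircoef f k x r != 0].
  apply: NNPP => no_k; case/eqP: fx0.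
  apply: (Z_XR _ _ Zx0) => // _ [x [r [Xx rR ->]]]; rewrite -(fX x Xx).
  have [p pE] := polyfam_curve x (polyfam_line r) f_pol.
  have p_const : p = (p`_0)%:P.
    apply/polyP => -[|k]; rewrite coefC //=; apply: NNPP => /eqP pk; apply: no_k.
    exists k.+1; split=> //; exists x, r; rewrite /dircoef (coefTE hK _ pE); split=> //.
      exact: XZ Xx.
    by apply: (subvP (addvSr _ _)).
  by rewrite -[r]scale1r pE -[x in RHS]addr0 -(scale0r r) pE p_const !hornerC.
have [q [[q_gt0 [x1 [r1 [Zx1 r1BR fr1]]]] q_min]] := nat_least ex_q.
have low x r k : Z W x -> r \in (B W + R W)%VS -> (0 < k < q)%N -> dircoef f k x r = 0.
  move=> Zx rBR /andP[k0 kq]; apply/eqP; apply: contraT => fk; case: (q_min k kq).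
  by split=> //; exists x, r.
have ZBR x r : Z W x -> r \in (B W + R W)%VS -> Z W (x + r) by apply: Z_BR.
have [r0 r0R fr0] : exists2 r0, r0 \in R W & dircoef f q x1 r0 != 0.
  case/memv_addP: r1BR fr1 => b bB [r0 r0R ->] fr1; exists r0 => //; apply: contra fr1.
  rewrite (dircoefD hK f_pol ZBR q_gt0 low Zx1) ?(subvP (addvSl _ _) _ bB)
    ?(subvP (addvSr _ _) _ r0R) //.
  by rewrite (dircoef_B hK f_B q_gt0 x1 bB) add0r.
pose h x := dircoef f q x r0.
have h_deg := poldeg_line hK r0 q f_deg.
have qe : (q <= e)%N.
  by move: h_deg; case: leqP => // _ h0; case/eqP: fr0; apply: h0.
rewrite qe in h_deg.
have h_pol : polyfun h by exists (e - q)%N.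
have h_B x b : b \in B W -> h (x + b) = h x.
  move=> bB; rewrite /h /dircoef; congr coefT; apply: functional_extensionality => t.
  by rewrite addrAC f_B.
(* [Y] is the part of [X] where all pullbacks of [h] vanish; it satisfies the equation [h] of degree
   [e - q]. *)
pose Y n (V : finType) (x : tens (U + V)%type) :=
  X n V x /\ forall g : W -> V -> K, h (act (blockm g) x) = 0.
have Y_chain : closed_chain Y.
  split=> [n|n V x [/X_decr Xx hx]] //; have [X_cl X_act X_B] := X_csub n.
  split=> [V x clx|V V' g x [Xx hx]|V x b [Xx hx] bB].
  - split=> [|g]; first by apply: X_cl; apply: zclosure_mono clx => y [].
    by apply: (clx (fun y => h (act (blockm g) y))) => [|y [_]//]; apply: polyfun_act_comp.
  - by split=> [|g']; [exact: X_act|rewrite act_comp mulm_blockm].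
  - split=> [|g]; first exact: X_B.
    by rewrite actD h_B //; apply: B_sub.
have [N1 YN] : stable_chain Y.
  apply: (IHe (e - q)%N _ W h) => //.
  - by rewrite ltn_subrL q_gt0 (leq_trans q_gt0).
  - by move=> n V x [/XZ].
  - by move=> x [_ /(_ (@idm K W))]; rewrite blockm_id act_id.
  - by exists x1.
have [N2 XN] := projection_chain W X_chain.
exists (maxn N1 N2) => n V x; rewrite geq_max => /andP[N1n N2n] Xx.
have [hx|nhx] := classic (forall g : W -> V -> K, h (act (blockm g) x) = 0).
  have : Y n V x; last by case.
  apply: YN => //; split=> //; exact: (chain_decr2 X_decr (leq_maxl N1 N2)).
have [g hg] : exists g : W -> V -> K, h (act (blockm g) x) != 0.
  apply: NNPP => no_g; apply: nhx => g; apply/eqP; apply: contraT => hg.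
  by case: no_g; exists g.
have XNx : X N2 V x by apply: (chain_decr2 X_decr (leq_maxr N1 N2)).
have [_ XN2_act _] := X_csub N2; have [_ Xn_act _] := X_csub n.
(* The graph of [g] takes [x] to a point over [act (blockm g) x], where [h] does not vanish, as
   [elimination] requires. *)
have : X n (W + V)%type (act (blockm (pairm g)) x).
  apply: (elimination hK d_gt0 B_sub R_sub R_deg R_irr Z_csub (X_csub 0%N) (XZ 0%N) f_pol f_B fX
    q_gt0 low r0R (X_csub n)).
  - by move=> z; apply: (chain_decr2 X_decr (leq0n n)).
  - by apply: X0_act; apply: (chain_decr2 X_decr (leq0n _)) Xx.
  - by rewrite act_comp mulm_blockm prl_pairm.
  - by apply: XN => //; apply: XN2_act.
by move/(Xn_act _ _ (@prr K W V)); rewrite act_comp mulm_blockm prr_pairm blockm_id act_id.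
Qed.

(** Noetherian induction on a bound [Z] for the chain, starting from the whole functor. A chain that
    misses a point of [Z] at some index provides the equation for [degree_step]; otherwise it is
    constantly [Z]. *)
Lemma noetherian_mod_step : noetherian_mod B.
Proof.
suff stab Z : closed_subfunctor (fun V => B V + R V)%VS Z ->
    forall X, closed_chain X -> (forall n V x, X n V x -> Z V x) -> stable_chain X.
  by move=> X X_csub X_decr; apply: (stab (fun _ _ => True)).
apply: (closed_subfunctor_ind (Q := fun Z => forall X, closed_chain X ->
  (forall n V x, X n V x -> Z V x) -> stable_chain X) noethBR) => {}Z Z_csub IHZ X X_chain XZ.
have [[k [V [x [Zx nXx]]]]|X_eq] := classic (exists k V x, Z V x /\ ~ X k V x).
  have [f [[e f_deg] f_B fX fx]] := closed_subfunctor_separates (X_chain.1 k) nXx.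
  apply: (@stable_tail k).
  apply: (degree_step Z_csub IHZ f_deg f_B (closed_chain_tail k X_chain)).
  - by move=> n; apply: XZ.
  - by rewrite addn0.
  - by exists x.
exists 0%N => n V x _ /XZ Zx; apply: NNPP => nXx; apply: X_eq.
by exists n, V, x.
Qed.

End Induction.

(** * Noetherianity of tensor functors *)

Section TwistSpan.
Variables (K : fieldType) (J : finType) (q : nat).
Hypothesis q_frob : frobenius_exponent K q.

Lemma frobmap_span (S : {vspace {ffun J -> K^o}}) s x :
  x \in (S + <<s>>)%VS -> frobmap q x \in (frobspan q S + <<map (frobmap q) s>>)%VS.
Proof.
case/memv_addP => a aS [b bs ->]; rewrite frobmapD //; apply: memv_add; first exact: mem_frobspan.
rewrite (coord_span (X := in_tuple s) bs) frobmap_sum //; apply: memv_suml => i _.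
rewrite frobmapZ memvZ // memv_span //; apply: map_f.
by rewrite mem_nth.
Qed.

Lemma spanned_mod_frobspan (S R : {vspace {ffun J -> K^o}}) m :
  spanned_mod S (fun x => x \in R) m -> spanned_mod (frobspan q S) (fun x => x \in frobspan q R) m.
Proof.
move=> [s [sm sR]]; exists (map (frobmap q) s); split=> [|x]; first by rewrite size_map.
by apply: subvP; apply: frobspan_sub => y /sR/frobmap_span.
Qed.

(** Coordinate subspaces are spanned by basis vectors, which [frobmap q] fixes, so bounds on them
    survive twisting. *)
Lemma support_frobmap_ind (P : pred J) (T : {vspace {ffun J -> K^o}}) :
    (forall x : {ffun J -> K^o}, (forall j, ~~ P j -> x j = 0) -> frobmap q x \in T) ->
  forall x : {ffun J -> K^o}, (forall j, ~~ P j -> x j = 0) -> x \in T.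
Proof.
move=> PT x xP; pose e j : {ffun J -> K^o} := [ffun j' => (j' == j)%:R].
have -> : x = \sum_j x j *: e j.
  apply/ffunP => j; rewrite sum_ffunE (bigD1 j) //= ffunZE ffunE eqxx mulr1.
  by rewrite big1 ?addr0 // => j' j'j; rewrite ffunZE ffunE eq_sym (negPf j'j) mulr0.
apply: memv_suml => j _; have [Pj|Pj] := boolP (P j); last by rewrite xP // scale0r mem0v.
apply: memvZ; have -> : e j = frobmap q (e j).
  apply/ffunP => j'; rewrite !ffunE; case: eqP => _; first by rewrite expr1n.
  by rewrite expr0n eqn0Ngt q_frob.1.
apply: PT => j'; rewrite ffunE; case: eqP => // ->.
by rewrite Pj.
Qed.

End TwistSpan.

Section Noetherianity.
Variables (K : fieldType) (I : finType).
Hypothesis hK : infinite K.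
Local Notation tens L := {ffun {ffun I -> L} -> K^o}.

Lemma pure_deg_vspace (U V : finType) d :
  exists T : {vspace tens (U + V)%type}, forall x, x \in T <-> pure_deg d x.
Proof.
apply: vspace_of_pred => [w _|a x y xd yd w wd]; first by rewrite ffunE.
by rewrite ffunE ffunZE xd // yd // mulr0 addr0.
Qed.

Lemma deg_ge_split (U V : finType) d (T : {vspace tens (U + V)%type}) :
    (forall x, deg_ge d.+1 x -> x \in T) -> (forall x, pure_deg d x -> x \in T) ->
  forall x, deg_ge d x -> x \in T.
Proof.
move=> T_ge T_pure x x_ge.
pose y : tens (U + V)%type := [ffun w => if vdeg w == d then x w else 0].
rewrite -(subrK y x) memvD //; last first.
  by apply: T_pure => w /negPf wd; rewrite ffunE wd.
apply: T_ge => w; rewrite ltnS leq_eqVlt ffunBE ffunE => /orP[->|wd]; first by rewrite subrr.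
by rewrite ltn_eqF // x_ge // subrr.
Qed.

Section Shift.
Variables (U W : finType) (d : nat).
Variables B R : forall V : finType, {vspace tens (U + V)%type}.
Hypotheses (B_sub : subfunctor B) (R_sub : subfunctor R).
Hypothesis B_ge : forall V x, deg_ge d.+1 x -> x \in B V.
Variable B' : forall V : finType, {vspace tens ((U + W) + V)%type}.
Hypothesis B'E : shifted B R B'.

Lemma subfunctor_shifted : subfunctor B'.
Proof.
move=> V V' f x /B'E[b [r [bB rR xE]]]; apply/B'E.
exists (act (blockm (blockm f)) b), (act (blockm f) r); split; [exact: B_sub|exact: R_sub|].
by rewrite act_comp assocm_blockm -act_comp xE actD !act_comp !mulm_blockm inrm_natural.
Qed.

Lemma act_assocm (V : finType) (x : tens ((U + W) + V)%type) w :
  act (@assocm K U W V) x w = x [ffun i => assocf (w i)].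
Proof. by apply: act_pull => i b; rewrite ffunE /assocm /funm eq_sym. Qed.

Lemma vdeg_assocf (V : finType) (w : {ffun I -> (U + (W + V))%type}) :
  (vdeg [ffun i => assocf (w i)] <= vdeg w)%N.
Proof. by apply: leq_sum => i _; rewrite ffunE; case: (w i) => [|[]]. Qed.

Lemma vdeg_assocf_lt (V : finType) (w : {ffun I -> (U + (W + V))%type}) i u :
  w i = inr (inl u) -> (vdeg [ffun i => assocf (w i)] < vdeg w)%N.
Proof.
move=> wi; rewrite /vdeg (bigD1 i) //= [in leqRHS](bigD1 i) //= ffunE wi /= add0n.
by rewrite add1n ltnS; apply: leq_sum => j _; rewrite ffunE; case: (w j) => [|[]].
Qed.

Lemma shifted_ge (V : finType) (x : tens ((U + W) + V)%type) : deg_ge d.+1 x -> x \in B' V.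
Proof.
move=> x_ge; apply/B'E; exists (act (@assocm K U W V) x), 0.
rewrite mem0v act0 addr0; split=> //; apply: B_ge => w wd.
by rewrite act_assocm x_ge // (leq_ltn_trans (vdeg_assocf w)).
Qed.

Definition liftf (V : finType) (a : (U + W) + V) : option (U + V) :=
  match a with inl (inl u) => Some (inl u) | inl (inr _) => None | inr v => Some (inr v) end.
Definition liftm (V : finType) (a : (U + W) + V) (b : U + V) : K := (liftf a == Some b)%:R.
Definition dropf (V : finType) (a : U + V) : (U + W) + V :=
  match a with inl u => inl (inl u) | inr v => inr v end.

Lemma assocm_liftm (V : finType) : mulm (@assocm K U W V) (@liftm V) = blockm (@inrm K W V).
Proof.
rewrite mulm_funm; apply: functional_extensionality => a; apply: functional_extensionality => b.
by case: a b => [u|[w|v]] [u'|v'].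
Qed.

(** Compare [x] with the lift of its restriction [y] to words without letters of [W]. After
    reassociation the difference has degree at least [d.+1] in [W + V], hence lies in [B], so the
    spanning family can be lifted from [U + V]. *)
Lemma shifted_spanned (V : finType) m :
    spanned_mod (B V + R V)%VS (fun x => pure_deg d x) m ->
  spanned_mod (B' V) (fun x => pure_deg d x) m.
Proof.
move=> [s [sm sE]]; exists (map (act (@liftm V)) s); split=> [|x x_d]; first by rewrite size_map.
pose y : tens (U + V)%type := act (funm K (@dropf V)) x.
have yE w : y w = x [ffun i => dropf (w i)].
  by apply: act_pull => i b; rewrite ffunE /funm eq_sym.
have y_d : pure_deg d y.
  move=> w wd; rewrite yE x_d //; apply: contra wd; rewrite /vdeg => /eqP<-.
  by apply/eqP/eq_bigr => i _; rewrite ffunE; case: (w i).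
have lift_y : act (@liftm V) y \in (B' V + <<map (act (@liftm V)) s>>)%VS.
  case/memv_addP: (sE y y_d) => _ /memv_addP[b bB [r rR ->]] [z zs ->].
  rewrite actD memv_add //.
    apply/B'E; exists (act (blockm (@inrm K W V)) b), r; split=> //; first exact: B_sub.
    by rewrite act_comp assocm_liftm actD.
  rewrite (coord_span (X := in_tuple s) zs) act_sum; apply: memv_suml => i _.
  by rewrite actZ memvZ // memv_span // map_f // mem_nth.
rewrite -(subrK (act (@liftm V) y) x) memvD //.
apply: (subvP (addvSl _ _)); apply/B'E; exists (act (@assocm K U W V) (x - act (@liftm V) y)), 0.
rewrite mem0v act0 addr0; split=> //; apply: B_ge => w wd.
rewrite actD actN act_comp assocm_liftm ffunBE act_assocm.
(* A word with a letter of [W] loses degree under reassociation, so [x] has coefficient 0 there. *)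
have [[i [u wi]]|noW] := classic (exists i u, w i = inr (inl u)).
  rewrite (act_zero _ (i := i)) => [|b]; last by rewrite wi; case: b.
  rewrite x_d ?subrr // neq_ltn.
  by rewrite (leq_trans (vdeg_assocf_lt wi)).
pose strip (a : U + (W + V)) : option (U + V) := liftf (assocf a).
have [w' w'E] : exists w' : {ffun I -> (U + V)%type}, forall i, strip (w i) = Some (w' i).
  have : forall i, exists b, strip (w i) = Some b.
    move=> i; rewrite /strip; case wi: (w i) => [u|[u|v]] /=;
      [by exists (inl u)| |by exists (inr v)].
    by case: noW; exists i, u.
  by move=> /dependent_choice[w' w'E]; exists (finfun w') => i; rewrite ffunE.
rewrite (act_pull _ (g := w')) => [|i b]; last first.
  by move: (w'E i); case: (w i) b => [u|[u|v]] [u'|v'] //= [<-] //; rewrite eq_sym.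
rewrite yE; have -> : [ffun i => dropf (w' i)] = [ffun i => assocf (w i)]; last exact: subrr.
apply/ffunP => i; rewrite !ffunE; move: (w'E i); rewrite /strip.
by case: (w i) => [u|[u|v]] //= [<-].
Qed.

End Shift.

(** Lexicographic induction on [d] and on a bound [c] for the rank, at ['I_d], of the top degree
    part modulo [B]. *)
Theorem noetherian_mod_bounded d : forall (U : finType)
    (B : forall V : finType, {vspace tens (U + V)%type}),
  subfunctor B -> (forall V x, deg_ge d.+1 x -> x \in B V) -> noetherian_mod B.
Proof.
elim: d => [|d IHd] U B B_sub B_ge; first exact: noetherian_mod_deg1.
have [c] : exists c, spanned_mod (B 'I_d.+1) (fun x => pure_deg d.+1 x) c.
  exists (\dim {: tens (U + 'I_d.+1)%type}).
  by apply: (spanned_mod_le (subvf _)) => [|x _]; rewrite ?leq_addl ?memvf.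
elim/ltn_ind: c U B B_sub B_ge => c IHc U B B_sub B_ge Bc.
have [B_pure|nB_pure] := classic (forall V x, pure_deg d.+1 x -> x \in B V).
  by apply: IHd => // V; apply: deg_ge_split; [apply: B_ge|apply: B_pure].
(* Minimising the rank of [R] over [B1] across all twists [B1] of [B], rather than over [B] alone,
   makes the quotient irreducible after every further twist. *)
pose good (B1 : forall V : finType, {vspace tens (U + V)%type}) :=
  [/\ subfunctor B1, noetherian_mod B1 -> noetherian_mod B,
      spanned_mod (B1 'I_d.+1) (fun x => pure_deg d.+1 x) c
    & forall V x, deg_ge d.+2 x -> x \in B1 V].
pose cand m := exists (B1 R : forall V : finType, {vspace tens (U + V)%type}),
  [/\ good B1, subfunctor R, forall V x, x \in R V -> pure_deg d.+1 x,
      exists V, ~~ (R V <= B1 V)%VS & spanned_mod (B1 'I_d.+1) (fun x => x \in R 'I_d.+1) m].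
have [|m [[B1 [R [B1_good R_sub R_deg [V0 RB1] Rm]]] m_min]] := @nat_least cand.
  have [T TE] : exists T : forall V : finType, {vspace tens (U + V)%type},
      forall V x, x \in T V <-> pure_deg d.+1 x.
    apply: (dependent_choice (Q := fun (V : finType) (T : {vspace tens (U + V)%type}) =>
      forall x, x \in T <-> pure_deg d.+1 x)) => V.
    exact: pure_deg_vspace.
  exists c, B, T; split=> // [V W f x /TE xd|V x /TE//||].
  - by apply/TE; apply: pure_deg_act.
  - apply: NNPP => noV; apply: nB_pure => V x /TE xT.
    have [/subvP/(_ _ xT)//|nTB] := boolP (T V <= B V)%VS.
    by case: noV; exists V.
  - by apply: spanned_mod_sub (subvv _) _ Bc => x /TE.
have [B1_sub B1_noeth B1c B1_ge] := B1_good; apply: (B1_noeth).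
(* [R] already leaves [B1] at ['I_d.+1], so adding it lowers [c] strictly. *)
have [r rR rB1] : exists2 r, r \in R 'I_d.+1 & r \notin B1 'I_d.+1.
  apply/subvPn; apply: contra RB1 => RB1.
  by apply: (subfunctor_restrict B1_sub R_sub R_deg).
have [c_gt0 BRc] := spanned_mod_extend (addvSl (B1 _) (R _)) (R_deg _ _ rR)
  (subvP (addvSr _ _) _ rR) rB1 B1c.
have c_lt : (c.-1 < c)%N by rewrite prednK.
apply: (@noetherian_mod_step K I hK U d.+1 isT B1 R) => //.
(* A failure of irreducibility after a twist would make [N], over the twist of [B1], a candidate of
   rank bound [m.-1]. *)
- move=> q q_frob N N_sub NR [V1 NB1] V; apply: contraT => RN; exfalso.
  have twB1_sub := subfunctor_frobspan hK q_frob B1_sub.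
  have twR_sub := subfunctor_frobspan hK q_frob R_sub.
  have twR_deg V2 x : x \in frobspan q (R V2) -> pure_deg d.+1 x.
    apply: (frobspan_ind (Q := fun x => pure_deg d.+1 x))
      => [w _|a y z yd zd w wd|y /R_deg yd w wd].
    + by rewrite ffunE.
    + by rewrite ffunE ffunZE yd // zd // mulr0 addr0.
    + by rewrite ffunE yd // expr0n eqn0Ngt q_frob.1.
  have NB_sub : subfunctor (fun V => N V + frobspan q (B1 V))%VS.
    move=> V2 V3 f _ /memv_addP[x xN [y yB ->]]; rewrite actD memv_add //; first exact: N_sub.
    exact: twB1_sub.
  have R_NB : ~~ (frobspan q (R 'I_d.+1) <= N 'I_d.+1 + frobspan q (B1 'I_d.+1))%VS.
    apply: contra RN => RN; exact: (subfunctor_restrict NB_sub twR_sub twR_deg).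
  have [m_gt0 Nm] := spanned_mod_proper (NR _) R_NB (spanned_mod_frobspan q_frob Rm).
  apply: (m_min m.-1); first by rewrite prednK.
  exists (fun V => frobspan q (B1 V)), N; split=> //; last by exists V1.
    split=> // [/(noetherian_mod_frobspan hK q_frob)/B1_noeth//||V2 x x_ge].
      have [s [sc sE]] := B1c; exists (map (frobmap q) s); split=> [|x x_d].
        by rewrite size_map.
      apply: (support_frobmap_ind q_frob (P := fun w => vdeg w == d.+1)) => // y y_d.
      by apply: frobmap_span => //; apply: sE.
    apply: (support_frobmap_ind q_frob (P := fun w => (d.+1 < vdeg w)%N)) => [y y_ge|w].
      by apply: mem_frobspan => //; apply: B1_ge => w; rewrite ltnS leqNgt; apply: y_ge.
    by rewrite -leqNgt -ltnS; apply: x_ge.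
  by move=> V2 x /(subvP (NR V2)); apply: twR_deg.
- apply: (IHc _ c_lt) => // [V W f _ /memv_addP[x xB [y yR ->]]|V x x_ge].
    by rewrite actD memv_add //; [exact: B1_sub|exact: R_sub].
  by apply: (subvP (addvSl _ _)); apply: B1_ge.
- move=> W B' B'E; apply: (IHc _ c_lt).
  + exact: subfunctor_shifted B'E.
  + exact: (shifted_ge B1_ge B'E).
  + exact: (shifted_spanned B1_sub B1_ge B'E BRc).
Qed.

End Noetherianity.

(** * Coordinates and monomials *)

Section PolynomialMonomials.
Variable K : fieldType.

Lemma poldeg_sum (E : vectType K) (J : Type) (r : seq J) (P : pred J) d (F : J -> E -> K) :
  (forall j, P j -> poldeg d (F j)) -> poldeg d (fun x => \sum_(j <- r | P j) F j x).
Proof.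
move=> F_d; elim: r => [|j r IHr].
  by under eq_fun => x do rewrite big_nil; apply: poldeg_le (leq0n d) (poldeg_const _ _).
under eq_fun => x do rewrite big_cons.
by case: (boolP (P j)) => // Pj; apply: poldeg_add => //; apply: F_d.
Qed.

Lemma poldeg_meval (E : vectType K) n (p : {mpoly K[n]}) (v : 'I_n -> E -> K) d :
  (forall i, scalar (v i)) -> (msize p <= d.+1)%N -> poldeg d (fun x => p.@[fun i => v i x]).
Proof.
move=> v_lin p_d; under eq_fun => x do rewrite mevalE big_seq.
apply: poldeg_sum => m mp; apply: (@poldeg_le _ _ (0 + mdeg m)).
  by rewrite add0n -ltnS (leq_trans (msize_mdeg_lt mp)).
apply: poldeg_mul; first exact: poldeg_const.
rewrite mdegE; elim: (index_enum 'I_n) => [|i r IHr].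
  rewrite big_nil; under eq_fun => x do rewrite big_nil.
  exact: poldeg_const.
rewrite big_cons; under [X in poldeg _ X]eq_fun => x do rewrite big_cons.
apply: poldeg_mul IHr.
elim: (m i) => [|k IHk]; first by under eq_fun => x do rewrite expr0; apply: poldeg_const.
rewrite -add1n; under eq_fun => x do rewrite exprS.
by apply: poldeg_mul IHk; apply: poldeg_lin.
Qed.

Lemma coordsE (E : vectType K) (x : E) i : coords x 0 i = coord (vbasis {:E}) i x.
Proof. exact/esym/passmx.coord_rVof. Qed.

Lemma coords_eq0 (E : vectType K) (x : E) : (forall i, coords x 0 i = 0) -> x = 0.
Proof.
move=> x0; rewrite (coord_vbasis (memvf x)) big1 // => i _.
by rewrite -coordsE x0 scale0r.
Qed.

Lemma scalar_coords (E : vectType K) i : scalar (fun x : E => coords x 0 i).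
Proof. by move=> a x y; rewrite !coordsE linearP. Qed.

Lemma zariski_zclosed (E : vectType K) (S : E -> Prop) : zariski_closed S -> zclosed S.
Proof.
move=> [Eqs SE] x clx; apply/SE => p pE.
apply: (clx (fun x => p.@[coords x 0])) => [|y /SE]; last exact.
exists (msize p); apply: poldeg_meval (leqnSn _) => i a y z.
exact: scalar_coords.
Qed.

Lemma poldeg_monomials (J : finType) d (u : {ffun J -> K^o} -> K) : poldeg d u ->
  exists s : seq (K * seq J), (forall t, t \in s -> (size t.2 <= d)%N) /\
    forall x, u x = \sum_(t <- s) t.1 * \prod_(j <- t.2) x j.
Proof.
elim=> {d u} [c|g g_lin|d f g _ [r [rd rE]] _ [s [sd sE]]|d e f g _ [r [rd rE]] _ [s [sd sE]]
             |d e f de _ [s [sd sE]]].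
- exists [:: (c, [::])]; split=> [t|x]; first by rewrite inE => /eqP->.
  by rewrite big_seq1 big_nil mulr1.
- exists [seq (g [ffun j' => (j' == j)%:R], [:: j]) | j <- enum J]; split=> [t /mapP[j _ ->]//|x].
  rewrite big_map big_enum scalar_ffunE //; apply: eq_bigr => j _.
  by rewrite big_seq1 mulrC.
- exists (r ++ s); split=> [t|x]; last by rewrite big_cat rE sE.
  by rewrite mem_cat => /orP[/rd|/sd].
- exists [seq (a.1 * b.1, a.2 ++ b.2) | a <- r, b <- s]; split=> [t|x].
    by move=> /allpairsP[[a b] [/rd ad /sd bd ->]]; rewrite size_cat leq_add.
  rewrite big_allpairs_dep rE sE big_distrl /=; apply: eq_bigr => a _.
  rewrite big_distrr /=; apply: eq_bigr => b _.
  by rewrite big_cat /= mulrACA.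
- by exists s; split=> // t /sd td; apply: leq_trans de.
Qed.

Lemma prod_onth (J : Type) (x : J -> K) d (t : seq J) : (size t <= d)%N ->
  \prod_(k < d) oapp x 1 (onth t k) = \prod_(j <- t) x j.
Proof.
elim: t d => [|j t IHt] d td.
  by rewrite big_nil big1 // => k _; rewrite onth_default.
case: d td => // d td; rewrite big_ord_recl big_cons /=; congr (_ * _).
by rewrite -(IHt d).
Qed.

End PolynomialMonomials.

Section LinearMaps.
Variable K : fieldType.

Lemma lfun_exists (E F : vectType K) (f : E -> F) : linear f -> exists L : 'Hom(E, F), L =1 f.
Proof.
move=> f_lin; pose g : {linear E -> F} := HB.pack f (GRing.isLinear.Build K E F *:%R f f_lin).
by exists (linfun g) => x; rewrite lfunE.
Qed.

Definition mxapp (V W : finType) (f : W -> V -> K) (x : {ffun V -> K^o}) : {ffun W -> K^o} :=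
  [ffun w => \sum_v f w v * x v].

Lemma mxapp_linear (V W : finType) (f : W -> V -> K) : linear (mxapp f).
Proof.
move=> a x y; apply/ffunP => w; rewrite ffunE [RHS]ffunE ffunZE !ffunE mulr_sumr -big_split /=.
by apply: eq_bigr => v _; rewrite ffunE ffunZE mulrDr mulrCA.
Qed.

HB.instance Definition _ (V W : finType) (f : W -> V -> K) :=
  GRing.isLinear.Build K {ffun V -> K^o} {ffun W -> K^o} *:%R (mxapp f) (mxapp_linear f).

Lemma mxapp_comp (V W X : finType) (f : X -> W -> K) (g : W -> V -> K) x :
  mxapp f (mxapp g x) = mxapp (mulm f g) x.
Proof.
apply/ffunP => a; rewrite !ffunE; under eq_bigr => b _ do rewrite ffunE mulr_sumr.
rewrite exchange_big /=; apply: eq_bigr => v _.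
by rewrite mulr_suml; apply: eq_bigr => b _; rewrite mulrA.
Qed.

Lemma mxapp_id (V : finType) x : mxapp (@idm K V) x = x.
Proof.
apply/ffunP => v; rewrite ffunE (bigD1 v) //= /idm eqxx mul1r big1 ?addr0 // => w.
by rewrite eq_sym => /negPf->; rewrite mul0r.
Qed.

Lemma retract_exists (E : vectType K) n : (\dim {:E} <= n)%N ->
  exists (f : 'Hom(E, {ffun 'I_n -> K^o})) (g : 'Hom({ffun 'I_n -> K^o}, E)), (g \o f = \1)%VF.
Proof.
move=> En; pose b := vbasis {:E}; pose wd := widen_ord En.
have [f fE] : exists f : 'Hom(E, {ffun 'I_n -> K^o}), forall x,
    f x = [ffun k => \sum_(i | wd i == k) coord b i x].
  apply: lfun_exists => a x y; apply/ffunP => k; rewrite ffunE [RHS]ffunE ffunZE !ffunE.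
  by rewrite mulr_sumr -big_split /=; apply: eq_bigr => i _; rewrite linearP.
have [g gE] : exists g : 'Hom({ffun 'I_n -> K^o}, E), forall x,
    g x = \sum_i (x (wd i) : K) *: b`_i.
  apply: lfun_exists => a x y; rewrite scaler_sumr -big_split /=; apply: eq_bigr => i _.
  by rewrite ffunE ffunZE scalerDl scalerA.
exists f, g; apply/lfunP => x; rewrite comp_lfunE id_lfunE gE fE.
rewrite [RHS](coord_vbasis (memvf x)); apply: eq_bigr => i _; congr (_ *: _).
rewrite ffunE (bigD1 i) //= big1 ?addr0 // => j /andP[/eqP ij /negP[]].
by apply/eqP/val_inj; move/(congr1 val): ij.
Qed.

End LinearMaps.

(** * Encoding a polynomial functor by tensors *)

Section DiagonalFunctor.
Variables (K : fieldType) (l : nat) (P : vec_functor K l).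
Hypothesis hK : infinite K.

Definition diag_obj (V : finType) : vec_obj K l := fun _ => {ffun V -> K^o} : vectType K.

Definition diag_hom (V W : finType) (f : W -> V -> K) : vec_hom (diag_obj V) (diag_obj W) :=
  fun _ => linfun (mxapp f).

Definition dmap (V W : finType) (f : W -> V -> K) : 'Hom(P (diag_obj V), P (diag_obj W)) :=
  fmap P (diag_hom f).

Lemma dmap_comp (V W X : finType) (f : X -> W -> K) (g : W -> V -> K) x :
  dmap f (dmap g x) = dmap (mulm f g) x.
Proof.
rewrite /dmap -comp_lfunE -fmap_comp; congr (fmap P _ x).
apply: functional_extensionality_dep => i; apply/lfunP => v.
rewrite /vec_comp comp_lfunE !lfunE /=.
 exact: mxapp_comp.
Qed.

Lemma dmap_id (V : finType) x : dmap (@idm K V) x = x.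
Proof.
rewrite /dmap (_ : diag_hom _ = vec_id (diag_obj V)) ?fmap_id ?id_lfunE //.
apply: functional_extensionality_dep => i; apply/lfunP => v.
rewrite /vec_id id_lfunE lfunE; exact: mxapp_id.
Qed.

Variable d : nat.
Hypothesis P_deg : forall V W : vec_obj K l, polynomial_of_degree_le d (@fmap _ _ P V W).

Lemma scalar_hom_coords (V W : finType) k :
  scalar (fun m : {ffun W * V -> K^o} =>
    vec_hom_coords (@diag_hom V W (fun a b => m (a, b) : K)) 0 k).
Proof.
move=> a m m'.
rewrite /vec_hom_coords !mxE -linearP; congr (coord _ _ _).
apply/lfunP => v; rewrite add_lfunE scale_lfunE !lfunE /=.
apply/ffunP => w; rewrite ffunE [RHS]ffunE ffunZE !ffunE mulr_sumr -big_split /=.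
by apply: eq_bigr => c _; rewrite ffunE ffunZE mulrDl mulrA.
Qed.

Lemma poldeg_dmap (V W : finType) x (g : P (diag_obj W) -> K) : scalar g ->
  poldeg d (fun m : {ffun W * V -> K^o} => g (dmap (fun a b => m (a, b) : K) x)).
Proof.
move=> g_lin; have [p [p_d pE]] := P_deg (diag_obj V) (diag_obj W).
pose b := vbasis {: 'Hom(P (diag_obj V), P (diag_obj W))}.
under eq_fun => m do rewrite [dmap _](coord_vbasis (memvf _)) sum_lfunE scalarf_sum //.
apply: poldeg_sum => j _.
under eq_fun => m do rewrite scale_lfunE scalarfZ // -coordsE pE mulrC.
rewrite -[d]add0n; apply: poldeg_mul; first exact: poldeg_const.
apply: poldeg_meval (p_d j) => k a m m'.
exact: scalar_hom_coords.
Qed.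

(** On diagonal matrices a form in [P(f) x] is a sum of monomials in at most [d] diagonal entries
    each. Projections to at most [d] coordinates factor through [K^d] and give 0, so
    inclusion-exclusion gives 0 at the identity. *)
Lemma dmap_separates (V : finType) x :
  (forall f : 'I_d -> V -> K, dmap f x = 0) -> x = 0.
Proof.
move=> fx; apply/eqP; rewrite -memv0; apply: contraT => x0.
have [g [g_lin _ /eqP[]]] := scalar_separates x0.
have [s [sd sE]] := poldeg_monomials (poldeg_dmap x g_lin).
have gE (f : V -> V -> K) : g (dmap f x) = \sum_(t <- s) t.1 * \prod_(ab <- t.2) f ab.1 ab.2.
  have := sE [ffun ab => f ab.1 ab.2].
  have -> : (fun a b => [ffun ab : V * V => f ab.1 ab.2 : K^o] (a, b)) = f.
    by do 2!apply: functional_extensionality => ?; rewrite ffunE.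
  move=> ->; apply: eq_bigr => t _; congr (_ * _); apply: eq_bigr => ab _; exact: ffunE.
pose isd (t : K * seq (V * V)) := all (fun ab => ab.1 == ab.2) t.2.
pose A (t : K * seq (V * V)) : {set V} := if isd t then [set v in map fst t.2] else set0.
have gS (S : {set V}) : g (dmap (diagm K S) x) =
    \sum_(t <- s | A t \subset S) (if isd t then t.1 else 0).
  rewrite gE [RHS]big_mkcond; apply: eq_bigr => t _; rewrite /A.
  case: (boolP (isd t)) => [/allP td|]; last first.
    case/allPn => ab abt /negPf ab_neq; rewrite sub0set.
    by rewrite (big_rem ab) //= /diagm ab_neq mul0r mulr0.
  case: ifP => [/subsetP tS|/subsetPn[v]].
    rewrite big_seq big1 ?mulr1 // => ab abt; rewrite /diagm td // tS // inE.
    exact: map_f.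
  rewrite inE => /mapP[ab abt ->] /negPf abS.
  by rewrite (big_rem ab) //= /diagm abS andbF mul0r mulr0.
pose v t : K^o := if isd t then t.1 else 0.
have sumE (S : {set V}) : g (dmap (diagm K S) x) =
    \sum_(i < size s | A (tnth (in_tuple s) i) \subset S) v (tnth (in_tuple s) i).
  by rewrite gS big_tnth.
have -> : x = dmap (diagm K setT) x.
  rewrite -[LHS]dmap_id; congr (dmap _ x).
  by do 2!apply: functional_extensionality => ?; rewrite /diagm inE andbT.
rewrite sumE (eq_bigl xpredT) => [|i]; last by rewrite subsetT.
suff : (\sum_(i < size s) v (tnth (in_tuple s) i) : K^o) \in 0%VS by rewrite memv0 => /eqP.
apply: (indicator_span (A := fun i => A (tnth (in_tuple s) i)) (d := d)) => [i|S Sd].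
  rewrite /A; case: ifP => _; last by rewrite cards0.
  rewrite cardsE (leq_trans (card_size _)) // size_map sd //.
  exact: mem_tnth.
rewrite -sumE; have [f1 [f2 <-]] := @diagm_factor K V S d Sd.
by rewrite -dmap_comp fx linear0 scalarf0 // mem0v.
Qed.

(** The additional position [None] always carries the label, which therefore survives in monomials
    that fill all [d] other positions. *)
Local Notation pos := (option 'I_d).
Local Notation out := 'I_(\dim {: P (diag_obj 'I_d)}).
Local Notation lab := (out * {ffun 'I_d -> option 'I_d})%type.
Local Notation tens L := {ffun {ffun pos -> L} -> K^o}.

(** A monomial [f u1 v1 * ... * f uk vk] in the entries of [f : V -> K^d], in the output coordinate
    [j], is encoded by the word with [vi] in position [i] and, elsewhere, the label [(j, s)] that
    records [j] and the row indices [s i = ui]. *)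
Definition letters (L : finType) j (s : {ffun 'I_d -> option 'I_d}) (t : 'I_d -> option L) :
    {ffun pos -> (lab + L)%type} :=
  [ffun i => if obind t i is Some a then inr a else inl (j, s)].

(** Contracts each position with the row index recorded for it in the label, summing over all labels
    with output [j]. *)
Definition readout (j : out) (b : tens (lab + 'I_d)%type) : K :=
  \sum_(s : {ffun 'I_d -> option 'I_d}) b (letters j s s).

Lemma scalar_readout j : scalar (readout j).
Proof.
move=> a x y; rewrite mulr_sumr -big_split /=; apply: eq_bigr => s _.
by rewrite ffunE ffunZE.
Qed.

Definition monomial (V : finType) (j : out) (t : seq ('I_d * V)) : tens (lab + V)%type :=
  [ffun w => (w == letters j [ffun k : 'I_d => omap fst (onth t k)]
                           (fun k : 'I_d => omap snd (onth t k)))%:R].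

Lemma act_delta (I L L' : finType) (f : L' -> L -> K) (w0 : {ffun I -> L}) w' :
  act f [ffun w => (w == w0)%:R] w' = \prod_i f (w' i) (w0 i).
Proof.
rewrite ffunE (bigD1 w0) //= ffunE eqxx mulr1 [X in _ + X]big1 ?addr0 // => w /negPf ww.
by rewrite ffunE ww mulr0.
Qed.

Lemma readout_monomial (V : finType) (f : 'I_d -> V -> K) j j0 t : (size t <= d)%N ->
  readout j (act (blockm f) (monomial j0 t)) = (j == j0)%:R * \prod_(ab <- t) f ab.1 ab.2.
Proof.
move=> td; pose s0 : {ffun 'I_d -> option 'I_d} := [ffun k : 'I_d => omap fst (onth t k)].
rewrite /readout (bigD1 s0) //= [X in _ + X]big1 => [|s ss0]; last first.
  rewrite act_delta (bigD1 None) //= !ffunE /= xpair_eqE (negPf ss0) andbF.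
  by rewrite mul0r.
rewrite addr0 act_delta (bigD1 None) //= !ffunE /= xpair_eqE eqxx andbT.
have [->|] := eqVneq j j0; last by rewrite !mul0r.
congr (_ * _); rewrite -(prod_onth (fun ab => f ab.1 ab.2) td).
rewrite (reindex_omap Some id) => [|[]//]; apply: eq_big => [k|k _]; first by rewrite /= eqxx.
rewrite !ffunE /= ffunE; case: (onth t k) => [[u v]|] //=.
by rewrite eqxx.
Qed.

(** [a] encodes the polynomial map [f |-> P(f) x] on [Hom(V, K^d)], which determines [x]. *)
Definition encodes (V : finType) (x : P (diag_obj V)) (a : tens (lab + V)%type) :=
  forall (f : 'I_d -> V -> K) j, coords (dmap f x) 0 j = readout j (act (blockm f) a).

Lemma encodes_exists (V : finType) (x : P (diag_obj V)) : exists a, encodes x a.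
Proof.
have [s sP] : exists s : out -> seq (K * seq ('I_d * V)), forall j,
    (forall t, t \in s j -> (size t.2 <= d)%N) /\
    forall m : {ffun 'I_d * V -> K^o}, coords (dmap (fun a b => m (a, b) : K) x) 0 j =
      \sum_(t <- s j) t.1 * \prod_(ab <- t.2) m ab.
  apply: (dependent_choice (Q := fun j s => (forall t, t \in s -> (size t.2 <= d)%N) /\
    forall m : {ffun 'I_d * V -> K^o}, coords (dmap (fun a b => m (a, b) : K) x) 0 j =
      \sum_(t <- s) t.1 * \prod_(ab <- t.2) m ab)) => j.
  exact: (poldeg_monomials (poldeg_dmap x (scalar_coords j))).
exists (\sum_j \sum_(t <- s j) t.1 *: monomial j t.2) => f j.
have := (sP j).2 [ffun ab => f ab.1 ab.2].
have -> : (fun a b => [ffun ab : 'I_d * V => f ab.1 ab.2 : K^o] (a, b)) = f.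
  by do 2!apply: functional_extensionality => ?; rewrite ffunE.
move=> ->; rewrite act_sum (scalarf_sum (scalar_readout j)) (bigD1 j) //=.
have readE j0 : readout j (act (blockm f) (\sum_(t <- s j0) t.1 *: monomial j0 t.2)) =
    \sum_(t <- s j0) t.1 * ((j == j0)%:R * \prod_(ab <- t.2) f ab.1 ab.2).
  rewrite (scalarf_sum (g := fun a => readout j (act (blockm f) a))); last first.
    exact: scalar_comp (act_linear _) (scalar_readout j).
  rewrite big_seq [RHS]big_seq; apply: eq_bigr => t ts.
  by rewrite actZ (scalarfZ (scalar_readout j)) readout_monomial // (sP j0).1.
rewrite [X in _ + X]big1 ?addr0 => [|j0 /negPf j0j].
  rewrite readE eqxx; apply: eq_bigr => t _; rewrite mul1r; congr (_ * _).
  by apply: eq_bigr => ab _; rewrite ffunE.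
by rewrite readE big1 // => t _; rewrite eq_sym j0j mul0r mulr0.
Qed.

Lemma encodes_dmap (V W : finType) (f : W -> V -> K) x a :
  encodes x a -> encodes (dmap f x) (act (blockm f) a).
Proof. by move=> xa g j; rewrite dmap_comp act_comp mulm_blockm; apply: xa. Qed.

(* The left-hand sides of [encodes] separate the points [x], hence span the dual space. *)
Lemma encodes_scalar (V : finType) (g : P (diag_obj V) -> K) : scalar g ->
  exists2 h : tens (lab + V)%type -> K, scalar h & forall x a, encodes x a -> g x = h a.
Proof.
move=> g_lin; pose b := vbasis {: P (diag_obj V)}; pose n := \dim {: P (diag_obj V)}.
pose Q (r : 'rV[K]_n) := exists fj : ('I_d -> V -> K) * out,
  r = \row_i coords (dmap fj.1 b`_i) 0 fj.2.
have [|A [QA A_unit]] := @row_family_unitmx K n Q.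
  move=> w wQ; pose x := \sum_i w i 0 *: b`_i.
  have x0 : x = 0.
    apply: dmap_separates => f; apply: coords_eq0 => j.
    have /matrixP/(_ 0 0) := wQ _ (ex_intro _ (f, j) erefl); rewrite !mxE => <-.
    rewrite !linear_sum; apply: eq_bigr => i _.
    by rewrite !linearZ /= mxE -coordsE mulrC.
  have /freeP := basis_free (vbasisP {: P (diag_obj V)}).
  by move=> /(_ (fun i => w i 0) x0) w0; apply/colP => i; rewrite w0 mxE.
have [fj fjE] := dependent_choice QA.
pose c i (a : tens (lab + V)%type) :=
  \sum_k invmx A i k * readout (fj k).2 (act (blockm (fj k).1) a).
have c_lin i : scalar (c i).
  move=> e u v; rewrite mulr_sumr -big_split /=; apply: eq_bigr => k _.
  by rewrite act_linear (scalar_readout _) mulrDr mulrCA.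
exists (fun a => \sum_i c i a * g b`_i) => [e u v|x a xa].
  rewrite mulr_sumr -big_split /=; apply: eq_bigr => i _.
  by rewrite c_lin mulrDl mulrA.
rewrite {1}(coord_vbasis (memvf x)) scalarf_sum //; apply: eq_bigr => i _.
rewrite scalarfZ //; congr (_ * _).
have AE : A *m (\col_i coord b i x) = \col_k readout (fj k).2 (act (blockm (fj k).1) a).
  apply/colP => k; rewrite !mxE -xa {2}(coord_vbasis (memvf x)) coordsE !linear_sum.
  apply: eq_bigr => i' _; rewrite !linearZ /= mxE -coordsE.
  have /rowP/(_ i') := fjE k; rewrite !mxE => ->.
  by rewrite mulrC.
have /(congr1 (mulmx (invmx A))) := AE; rewrite mulKmx // => /colP/(_ i).
by rewrite !mxE => ->; apply: eq_bigr => k _; rewrite mxE.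
Qed.

Lemma encodes_polyfun (V : finType) (p : P (diag_obj V) -> K) : polyfun p ->
  exists2 h : tens (lab + V)%type -> K, polyfun h & forall x a, encodes x a -> p x = h a.
Proof.
elim/polyfun_ind => [c|g g_lin|g1 g2 [h1 h1p h1E] [h2 h2p h2E]|g1 g2 [h1 h1p h1E] [h2 h2p h2E]].
- by exists (fun=> c) => //; apply: polyfun_const.
- by have [h /polyfun_lin] := encodes_scalar g_lin; exists h.
- exists (fun a => h1 a + h2 a) => [|x a xa]; first exact: polyfunD.
  by rewrite (h1E _ _ xa) (h2E _ _ xa).
- exists (fun a => h1 a * h2 a) => [|x a xa]; first exact: polyfunM.
  by rewrite (h1E _ _ xa) (h2E _ _ xa).
Qed.

Lemma diag_noetherian (X : nat -> forall V : finType, P (diag_obj V) -> Prop) :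
    (forall n V, zclosed (X n V)) ->
    (forall n (V W : finType) (f : W -> V -> K) x, X n V x -> X n W (dmap f x)) ->
    (forall n V x, X n.+1 V x -> X n V x) ->
  exists N, forall n V x, (N <= n)%N -> X N V x -> X n V x.
Proof.
move=> X_cl X_dmap X_decr.
(* [B V] consists of the tensors that encode 0. *)
have [B BE] : exists B : forall V : finType, {vspace tens (lab + V)%type}, forall V a,
    a \in B V <-> forall (f : 'I_d -> V -> K) j, readout j (act (blockm f) a) = 0.
  apply: (dependent_choice (Q := fun (V : finType) (B : {vspace tens (lab + V)%type}) => forall a,
    a \in B <-> forall (f : 'I_d -> V -> K) j, readout j (act (blockm f) a) = 0)) => V.
  apply: vspace_of_pred => [f j|c a b a0 b0 f j].
    by rewrite act0 (scalarf0 (scalar_readout j)).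
  by rewrite act_linear scalar_readout a0 b0 mulr0 addr0.
have B_sub : subfunctor B.
  by move=> V W f a /BE aB; apply/BE => g j; rewrite act_comp mulm_blockm.
pose XT n (V : finType) (a : tens (lab + V)%type) := exists2 x, X n V x & encodes x a.
have [|||N XN] := @noetherian_mod_bounded K _ hK #|{: pos}| _ B B_sub _
  (fun n V => zclosure (@XT n V)).
(* A word has only [#|pos|] letters, so a tensor of larger degree is zero. *)
- move=> V a a_ge; suff -> : a = 0 by apply: mem0v.
  apply/ffunP => w; rewrite a_ge ?ffunE // ltnS -sum1_card.
  by apply: leq_sum => i _; case: (isr _).
- move=> n; apply: closed_subfunctor_zclosure => [V W f a [x Xx xa]|V a b [x Xx xa] /BE bB].
    by exists (dmap f x); [exact: X_dmap|exact: encodes_dmap].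
  exists x => // f j; rewrite actD (scalarfD (scalar_readout j)) bB addr0.
  exact: xa.
- by move=> n V a; apply: zclosure_mono => b [x /X_decr Xx xb]; exists x.
exists N => n V x Nn Xx; apply: X_cl => p p_pol pX.
have [a xa] := encodes_exists x; have [h h_pol hE] := encodes_polyfun p_pol.
rewrite (hE _ _ xa); apply: (XN n V a Nn) => //; first by apply: sub_zclosure; exists x.
by move=> b [y Xy yb]; rewrite -(hE _ _ yb) pX.
Qed.

End DiagonalFunctor.

(** * Reduction to the diagonal *)

Theorem corollary9 (K : fieldType) (hK : infinite K) (l : nat) (hl : (0 < l)%N)
    (P : vec_functor K l) (hP : polynomial_of_bounded_degree P) :
  noetherian P.
Proof.
move=> X X_decr; have [d P_deg] := hP.
have [|||N XN] := @diag_noetherian K l P hK d P_deg (fun n V => X n (@diag_obj K l V)).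
- by move=> n V; apply: zariski_zclosed; apply: points_closed.
- by move=> n V W f x; apply: points_fmap.
- by move=> n V x; apply: X_decr.
exists N => n Nn V x; split.
  by apply: (@chain_decr _ (fun n => @points K l P (X n) V)) => // k y; apply: X_decr.
(* Every [V i] is a retract of [K^m], so membership of [x] can be tested on the diagonal object and
   the index [N] found there serves all [V]. *)
pose m := \max_i \dim {: V i}.
have [f fP] : exists f : forall i, 'Hom(V i, {ffun 'I_m -> K^o}), forall i,
    exists g : 'Hom({ffun 'I_m -> K^o}, V i), (g \o f i = \1)%VF.
  apply: (dependent_choice (Q := fun i (f : 'Hom(V i, {ffun 'I_m -> K^o})) =>
    exists g : 'Hom({ffun 'I_m -> K^o}, V i), (g \o f = \1)%VF)) => i.
  by apply: retract_exists; apply: (leq_bigmax i).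
have [g gP] := dependent_choice fP.
have fg : vec_comp (U := V) (V := @diag_obj K l 'I_m) (W := V) g f = vec_id V.
  by apply: functional_extensionality_dep => i; apply: gP.
move=> Xx; rewrite -[x]id_lfunE -fmap_id -fg fmap_comp comp_lfunE.
by apply: points_fmap; apply: XN => //; apply: points_fmap.
Qed.
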